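(* Let $\mathcal A$ be a unital C$^*$-algebra and $\mathcal D=\{a\in\mathcal A:\|a\|<1\}$. The exponential map $\mathrm{Exp}_0:(T\mathcal D)_0\simeq\mathcal A\to\mathcal D$ of $\mathcal D$ at $0$ and its inverse $\mathrm{Log}_0:\mathcal D\to(T\mathcal D)_0$ are given explicitly as follows. If $z\in\mathcal D$ has polar decomposition $z=\omega|z|$, then $$\mathrm{Log}_0(z)=\tfrac12\,\omega\log\big((1+|z|)(1-|z|)^{-1}\big).$$ If $\alpha\in\mathcal A\simeq(T\mathcal D)_0$ has polar decomposition $\alpha=\omega|\alpha|$, then $$\mathrm{Exp}_0(\alpha)=\omega\tanh(|\alpha|).$$ In particular, if $\alpha=\mathrm{Log}_0(z)$ (equivalently, $z=\mathrm{Exp}_0(\alpha)$), then $z$ and $\alpha$ have the same partial isometry in the polar decomposition. Also $$|\mathrm{Exp}_0(\alpha)|=\tanh(|\alpha|)\quad\text{and}\quad|\mathrm{Log}_0(z)|=\tfrac12\log\big((1+|z|)(1-|z|)^{-1}\big).$$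
   Context: Polar decompositions are performed in $\mathcal A^{**}$ (the enveloping von Neumann algebra, $\mathcal A$ being taken in its universal representation), so $\omega\in\mathcal A^{**}$; $|z|=(z^*z)^{1/2}$. Let $\theta(\mathbf x,\mathbf y)=x_1^*y_1-x_2^*y_2$ on $\mathcal A^2$ and let $\mathcal U(\theta)$ be the group of invertible $\tilde g\in M_2(\mathcal A)$ preserving $\theta$, acting on $\mathcal D$ by $\tilde g\cdot w=(g_{21}+g_{22}w)(g_{11}+g_{12}w)^{-1}$. The geodesic of $\mathcal D$ starting at $0$ with initial velocity $\alpha\in\mathcal A=(T\mathcal D)_0$ is $\delta(t)=\exp\left(t\begin{pmatrix}0&\alpha^*\\\alpha&0\end{pmatrix}\right)\cdot0$, and $\mathrm{Exp}_0(\alpha)=\delta(1)$. For each $z\in\mathcal D$ there is a unique geodesic with $\delta(0)=0$ and $\delta(1)=z$, and its initial velocity is $\alpha=z\sum_{k=0}^\infty\frac1{2k+1}(z^*z)^k$; thus $\mathrm{Exp}_0$ is bijective, with inverse $\mathrm{Log}_0(z)=\alpha$. *)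

(* Defs.v *)
From HB Require Import structures.
From mathcomp Require Import all_boot all_order all_algebra.
From mathcomp Require Import complex.
From mathcomp Require Import all_classical all_reals all_analysis.

Set Implicit Arguments.
Unset Strict Implicit.
Unset Printing Implicit Defensive.

Import Order.TTheory GRing.Theory Num.Theory.
Import numFieldNormedType.Exports.

Local Open Scope classical_set_scope.
Local Open Scope ring_scope.
Local Open Scope complex_scope.

(* The norm is carried as real-valued data on an algebra: normed modules and
   rings have no common substructure below Num.NumDomain in the hierarchy, so
   completeNormedModType and algType cannot be joined.  unitAlgType only adds the
   total function ^-1, which is the two-sided inverse on the set of invertible
   elements; every algebra has such a structure classically. *)
HB.mixin Record isCStarAlgebra (R : realType) A
    of GRing.UnitAlgebra R[i] A := {
  cnorm : A -> R ;
  cnorm_eq0 : forall a : A, cnorm a = 0 -> a = 0 ;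
  cnormD : forall a b : A, cnorm (a + b) <= cnorm a + cnorm b ;
  cnormZ : forall (c : R[i]) (a : A), (cnorm (c *: a))%:C = `|c| * (cnorm a)%:C ;
  cnormM : forall a b : A, cnorm (a * b) <= cnorm a * cnorm b ;
  cnorm_complete : forall u : nat -> A,
    (forall e : R, 0 < e -> exists N : nat, forall m n : nat,
       (N <= m)%N -> (N <= n)%N -> cnorm (u m - u n) < e) ->
    exists l : A, (fun n => cnorm (u n - l)) @ \oo --> (0 : R) ;
  star : A -> A ;
  starD : forall a b : A, star (a + b) = star a + star b ;
  starZ : forall (c : R[i]) (a : A), star (c *: a) = Num.conj c *: star a ;
  starM : forall a b : A, star (a * b) = star b * star a ;
  starK : forall a : A, star (star a) = a ;
  cnorm_star : forall a : A, cnorm (star a * a) = cnorm a ^+ 2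
}.

#[short(type="cstarAlgType")]
HB.structure Definition CStarAlgebra (R : realType) :=
  {A of isCStarAlgebra R A & GRing.UnitAlgebra R[i] A}.

(* The inner product is linear in its first argument. *)
HB.mixin Record isHilbert (R : realType) H of CompleteNormedModule R[i] H := {
  inner : H -> H -> R[i] ;
  innerDl : forall x y z : H, inner (x + y) z = inner x z + inner y z ;
  innerZl : forall (c : R[i]) (x y : H), inner (c *: x) y = c * inner x y ;
  inner_conj : forall x y : H, inner y x = Num.conj (inner x y) ;
  inner_norm : forall x : H, inner x x = `|x| ^+ 2
}.

#[short(type="hilbertType")]
HB.structure Definition Hilbert (R : realType) :=
  {H of isHilbert R H & CompleteNormedModule R[i] H}.

Section CStar.
Variables (R : realType) (A : cstarAlgType R).
Implicit Types (a b z alpha : A).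

Definition norm_cvg (u : nat -> A) (l : A) : Prop :=
  (fun n => cnorm (u n - l)) @ \oo --> (0 : R).

Definition norm_lim (u : nat -> A) : A := xget 0 [set l | norm_cvg u l].

Definition spectrum a : set R[i] := [set l | (a - l%:A) \isn't a GRing.unit].

(* [is_cfc f a b] says that b = f(a) in the sense of the continuous functional
   calculus of the self-adjoint element a: b is the norm limit of q_n(a) for
   real polynomials q_n that converge to f uniformly on the spectrum of a
   (which is real). *)
Definition is_cfc (f : R -> R) a b : Prop :=
  star a = a /\
  exists2 q : nat -> {poly R},
    {uniform [set t : R | spectrum a t%:C],
      (fun (n : nat) (t : R) => (q n).[t]) @ \oo --> f}
    & norm_cvg (fun n => horner_alg a (map_poly (real_complex R) (q n))) b.

Definition cfc (f : R -> R) a : A := xget 0 [set b | is_cfc f a b].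

(* (z^* z)^(1/2) *)
Definition cabs z : A := cfc Num.sqrt (star z * z).

Definition tanh (t : R) : R := (expR t - expR (- t)) / (expR t + expR (- t)).

Definition unit_ball : set A := [set a | cnorm a < 1].

Definition mx2 (a b c d : A) : 'M[A]_2 :=
  \matrix_(i, j) if i == 0 then if j == 0 then a else b
                 else if j == 0 then c else d.

(* Entrywise convergence is convergence in the C*-norm of M_2(A). *)
Definition expmx2 (M : 'M[A]_2) : 'M[A]_2 :=
  \matrix_(i, j)
    norm_lim (fun n => \sum_(k < n) (k`!%:R^-1 : R[i]) *: (M ^+ k) i j).

(* The action on the unit ball of the invertible matrices preserving the form
   x_1^* y_1 - x_2^* y_2 on A^2. *)
Definition moebius (g : 'M[A]_2) (w : A) : A :=
  (g 1 0 + g 1 1 * w) * (g 0 0 + g 0 1 * w)^-1.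

(* The geodesic starting at 0 with initial velocity alpha. *)
Definition geodesic0 alpha (t : R) : A :=
  moebius (expmx2 (map_mx ( *:%R t%:C) (mx2 0 (star alpha) alpha 0))) 0.

Definition Exp0 alpha : A := geodesic0 alpha 1.

(* The inverse of Exp0, meaningful on the unit ball. *)
Definition Log0 z : A := xget 0 [set alpha | Exp0 alpha = z].

Definition is_state (phi : A -> R[i]) : Prop :=
  [/\ forall a b, phi (a + b) = phi a + phi b,
      forall (c : R[i]) a, phi (c *: a) = c * phi a,
      forall a, 0 <= phi (star a * a)
    & phi 1 = 1].

End CStar.

Section Operators.
Variables (R : realType) (H : hilbertType R).

Definition bounded_operator (T : H -> H) : Prop :=
  [/\ forall x y, T (x + y) = T x + T y,
      forall (c : R[i]) x, T (c *: x) = c *: T x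
    & continuous T].

Definition commutant (S : set (H -> H)) : set (H -> H) :=
  [set T | bounded_operator T /\ forall s, S s -> T \o s = s \o T].

Definition partial_isometry (T : H -> H) : Prop :=
  bounded_operator T /\
  forall x, (forall y, T y = 0 -> inner x y = 0) -> `|T x| = `|x|.

Definition linear_span (S : set H) : set H :=
  [set x | exists (n : nat) (c : 'I_n -> R[i]) (v : 'I_n -> H),
     (forall i, S (v i)) /\ x = \sum_(i < n) c i *: v i].

End Operators.

Section Representations.
Variables (R : realType) (A : cstarAlgType R) (H : hilbertType R).
Implicit Types (pi : A -> H -> H).

Definition is_representation pi : Prop :=
  [/\ forall a, bounded_operator (pi a),
      forall a b x, pi (a + b) x = pi a x + pi b x,
      forall (c : R[i]) a x, pi (c *: a) x = c *: pi a x,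
      (forall a b x, pi (a * b) x = pi a (pi b x)) /\ (forall x, pi 1 x = x)
    & forall a x y, inner (pi a x) y = inner x (pi (star a) y)].

(* The universal representation is the Hilbert direct sum, over all states phi,
   of the GNS representations of phi.  The GNS representation of phi is the
   cyclic representation with a cyclic vector xi_phi inducing phi (determined
   up to unitary equivalence); its summand in H is the closure of
   pi(A) xi_phi. *)
Definition is_universal_representation pi : Prop :=
  is_representation pi /\
  exists xi : (A -> R[i]) -> H,
  [/\ forall phi, is_state phi ->
        forall a, phi a = inner (pi a (xi phi)) (xi phi),
      forall phi psi, is_state phi -> is_state psi -> phi <> psi ->
        forall a b, inner (pi a (xi phi)) (pi b (xi psi)) = 0
    & dense (linear_span
        [set x | exists2 phi, is_state phi & exists a, x = pi a (xi phi)])].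

(* The enveloping von Neumann algebra, as the bicommutant of pi(A) when pi is
   the universal representation. *)
Definition enveloping_vN pi : set (H -> H) :=
  commutant (commutant (range pi)).

(* [is_polar pi z omega]: z = omega |z| is the polar decomposition of z, i.e.
   omega is the partial isometry with the same kernel as z. *)
Definition is_polar pi (z : A) (omega : H -> H) : Prop :=
  [/\ enveloping_vN pi omega,
      partial_isometry omega,
      pi z = omega \o pi (cabs z)
    & forall x, omega x = 0 <-> pi z x = 0].

End Representations.

(* Main.v *)
(* In a C*-algebra the exponential of the matrix with off-diagonal entries
   alpha^* and alpha has first column cosh |alpha| and
   alpha sinh |alpha| / |alpha|, so that Exp0 alpha = alpha g(alpha^* alpha)
   with g(s) = tanh (sqrt s) / sqrt s.  Hence z = Exp0 alpha satisfies
   z^* z = tanh^2 |alpha|, and this is inverted by alpha = z l(z^* z) with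
   l(r) = artanh (sqrt r) / sqrt r.  All the identities between z, alpha, |z| and
   |alpha| are identities between functions of the single self-adjoint element
   alpha^* alpha (or z^* z), and z = omega |z| passes to alpha because alpha and
   |alpha| arise from z and |z| by right multiplication with the same invertible
   element.

   The continuous functional calculus rests on an elementary proof that the norm
   of a self-adjoint element belongs to its spectrum up to sign, which uses only
   square roots of 1 - x for |x| < 1 instead of the spectral radius formula. *)

Require Import Defs.
From HB Require Import structures.
From mathcomp Require Import all_boot all_order all_algebra.
From mathcomp Require Import complex ring lra.
From mathcomp Require Import all_classical all_reals all_analysis.

Set Implicit Arguments.
Unset Strict Implicit.
Unset Printing Implicit Defensive.

Import Order.TTheory GRing.Theory Num.Theory.
Import numFieldNormedType.Exports.

Local Open Scope classical_set_scope.
Local Open Scope ring_scope.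
Local Open Scope complex_scope.

(** The partial isometry [omega] lives in the bicommutant, not in [A], and [|alpha|] need not be
    invertible, so [alpha] cannot be divided by [|alpha|] inside [A]. Taking sinh(r)/r as a power
    series in s = r^2 avoids the division: [Exp0] becomes right multiplication of [alpha] by an
    element of the functional calculus of [star alpha * alpha], and [omega] enters only when polar
    decompositions are compared. Two points shape the rest. The spectrum of [star a * a] must be
    known to be nonnegative: at negative s the cosh series is a cosine and may vanish, and
    [Num.sqrt] is no longer a square root. And existence and inversion in the calculus are stated
    for functions continuous on an interval containing the spectrum, so that they reduce to real
    analysis on segments. *)

(** * Norm, involution, norm convergence and the Neumann series *)

Section Norm.
Variables (R : realType) (A : cstarAlgType R).
Implicit Types (a b x y : A) (u v : nat -> A).

Lemma cnormZr (t : R) a : cnorm (t%:C *: a) = `|t| * cnorm a.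
Proof.
have := cnormZ t%:C a; rewrite normc_def /= expr0n addr0 sqrtr_sqr.
by rewrite -rmorphM => /complexI.
Qed.

Lemma cnorm0 : cnorm (0 : A) = 0.
Proof. by rewrite -(scale0r 0) cnormZr normr0 mul0r. Qed.

Lemma cnormN a : cnorm (- a) = cnorm a.
Proof. by have := cnormZr (-1) a; rewrite rmorphN1 scaleN1r normrN1 mul1r. Qed.

Lemma cnorm_ge0 a : 0 <= cnorm a.
Proof. by have := cnormD a (- a); rewrite subrr cnorm0 cnormN; lra. Qed.

Lemma cnormB a b : cnorm (a - b) <= cnorm a + cnorm b.
Proof. by rewrite -(cnormN b) cnormD. Qed.

Lemma cnorm_distC a b : cnorm (a - b) = cnorm (b - a).
Proof. by rewrite -cnormN opprB. Qed.

Lemma cnorm_gt0 a : a != 0 -> 0 < cnorm a.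
Proof.
move=> a0; rewrite lt_neqAle cnorm_ge0 andbT; apply: contra_neq a0 => /esym.
exact: cnorm_eq0.
Qed.

Lemma starZr (t : R) a : star (t%:C *: a) = t%:C *: star a.
Proof. by rewrite starZ; congr (_ *: _); exact: conjc_real. Qed.

Lemma star0 : star (0 : A) = 0.
Proof. by rewrite -{1}(scale0r 0) starZ conjC0 scale0r. Qed.

Lemma starN a : star (- a) = - star a.
Proof. by have := starZr (-1) a; rewrite rmorphN1 !scaleN1r. Qed.

Lemma starB a b : star (a - b) = star a - star b.
Proof. by rewrite starD starN. Qed.

Lemma star1 : star (1 : A) = 1.
Proof. by rewrite -[LHS]mul1r -{1}(starK 1) -starM mul1r starK. Qed.

Lemma starC (t : R) : star (t%:C%:A : A) = t%:C%:A.
Proof. by rewrite starZr star1. Qed.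

Lemma star_sqr_sa a : star a = a -> star (a ^+ 2) = a ^+ 2.
Proof. by move=> sa; rewrite expr2 starM sa. Qed.

Lemma cnorm_sqr_sa a : star a = a -> cnorm (a ^+ 2) = cnorm a ^+ 2.
Proof. by move=> sa; rewrite -cnorm_star sa expr2. Qed.

Lemma cnorm_starE a : cnorm (star a) = cnorm a.
Proof.
suff le_norm b : cnorm b <= cnorm (star b).
  by apply/le_anti; rewrite le_norm -{2}(starK a) le_norm.
have [->|b0] := eqVneq b 0; first by rewrite star0.
have bp := cnorm_gt0 b0.
by rewrite -(ler_pM2r bp) -expr2 -cnorm_star cnormM.
Qed.

Lemma cnorm1 : cnorm (1 : A) = 1.
Proof.
have h := cnorm_star (1 : A); rewrite star1 mulr1 in h.
have n0 : cnorm (1 : A) != 0.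
  by apply/eqP => /cnorm_eq0 /eqP; rewrite oner_eq0.
by apply: (mulfI n0); rewrite -expr2 -h mulr1.
Qed.

Lemma cnormCr (t : R) : cnorm (t%:C%:A : A) = `|t|.
Proof. by rewrite cnormZr cnorm1 mulr1. Qed.

Lemma cnormX a n : cnorm (a ^+ n) <= cnorm a ^+ n.
Proof.
elim: n => [|n IH]; first by rewrite !expr0 cnorm1.
rewrite !exprS (le_trans (cnormM _ _))//.
by rewrite ler_wpM2l ?cnorm_ge0.
Qed.

Lemma norm_cvg_squeeze u l (e : nat -> R) :
  (forall n, cnorm (u n - l) <= e n) -> e @ \oo --> (0 : R) -> norm_cvg u l.
Proof.
move=> ule e0; apply: (squeeze_cvgr _ (@cvg_cst _ (0 : R) _ _ _) e0).
by apply: nearW => n /=; rewrite cnorm_ge0 ule.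
Qed.

Lemma norm_cvgP u l : norm_cvg u l <->
  forall e : R, 0 < e ->
    exists N, forall n, (N <= n)%N -> cnorm (u n - l) < e.
Proof.
split=> [/cvgrPdist_lt ul e e0|ul].
  have [N _ Nu] := ul e e0; exists N => n Nn.
  by have := Nu n Nn; rewrite /= sub0r normrN ger0_norm ?cnorm_ge0.
apply/cvgrPdist_lt => e e0; have [N Nu] := ul e e0.
by exists N => // n /= Nn; rewrite sub0r normrN ger0_norm ?cnorm_ge0 ?Nu.
Qed.

Lemma norm_cvg_unique u l l' : norm_cvg u l -> norm_cvg u l' -> l = l'.
Proof.
move=> /norm_cvgP ul /norm_cvgP ul'.
apply/eqP; apply: contraT; rewrite -subr_eq0 => /cnorm_gt0 ll.
have h : 0 < cnorm (l - l') / 2 by rewrite divr_gt0.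
have [N uN] := ul _ h; have [M uM] := ul' _ h.
have := uN _ (leq_maxl N M); have := uM _ (leq_maxr N M).
set x := u _ => ? ?; have := cnormB (x - l') (x - l).
by rewrite opprB addrC subrKA; lra.
Qed.

Lemma norm_cvg_cst l : norm_cvg (fun=> l : A) l.
Proof. by apply/norm_cvgP => e e0; exists 0%N => n _; rewrite subrr cnorm0. Qed.

Lemma norm_cvgD u v l m :
  norm_cvg u l -> norm_cvg v m -> norm_cvg (fun n => u n + v n) (l + m).
Proof.
move=> ul vm; apply: (@norm_cvg_squeeze _ _ (fun n => cnorm (u n - l) +
  cnorm (v n - m))) => [n|]; first by rewrite opprD addrACA cnormD.
by rewrite -(addr0 0); apply: cvgD.
Qed.

Lemma norm_cvgM u v l m :
  norm_cvg u l -> norm_cvg v m -> norm_cvg (fun n => u n * v n) (l * m).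
Proof.
move=> ul vm; apply: (@norm_cvg_squeeze _ _ (fun n => cnorm (u n - l) *
  (cnorm (v n - m) + cnorm m) + cnorm l * cnorm (v n - m))) => [n|].
  have -> : u n * v n - l * m = (u n - l) * v n + l * (v n - m).
    by rewrite mulrBl mulrBr addrA subrK.
  apply: (le_trans (cnormD _ _)); apply: lerD; last exact: cnormM.
  apply: (le_trans (cnormM _ _)); apply: ler_wpM2l; first exact: cnorm_ge0.
  by have := cnormD (v n - m) m; rewrite subrK.
have -> : (0 : R) = 0 * (0 + cnorm m) + cnorm l * 0 by rewrite mul0r mulr0 addr0.
apply: cvgD; last exact: cvgMr.
by apply: cvgM => //; apply: cvgD => //; exact: cvg_cst.
Qed.

Lemma norm_cvgN u l : norm_cvg u l -> norm_cvg (fun n => - u n) (- l).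
Proof.
by move=> ul; apply: norm_cvg_squeeze ul => n; rewrite -opprD cnormN.
Qed.

Lemma norm_cvg_star u l : norm_cvg u l -> norm_cvg (fun n => star (u n)) (star l).
Proof.
by move=> ul; apply: norm_cvg_squeeze ul => n; rewrite -starB cnorm_starE.
Qed.

Lemma geometric_cvg u (C q : R) : 0 <= q < 1 ->
  (forall n, cnorm (u n.+1 - u n) <= C * q ^+ n) -> exists l, norm_cvg u l.
Proof.
move=> /andP[q0 q1] uq; apply: cnorm_complete => e e0.
(* The geometric sum is kept in closed form, with its factor [1 - q ^+ k], so that the induction on
   [k] closes exactly. *)
have dist n k : cnorm (u (n + k)%N - u n) <= C * q ^+ n * (1 - q ^+ k) / (1 - q).
  elim: k => [|k IH]; first by rewrite addn0 !subrr cnorm0 mulr0 mul0r.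
  rewrite addnS -(subrKA (u (n + k)%N)).
  apply: (le_trans (cnormD _ _)); apply: (le_trans (lerD (uq _) IH)).
  by rewrite exprD exprSr le_eqVlt; apply/orP; left; apply/eqP; field; lra.
have C0 : 0 <= C by have := uq 0%N; rewrite expr0 mulr1; apply: le_trans (cnorm_ge0 _).
have q1' : 0 < 1 - q by lra.
have : (fun n => C / (1 - q) * q ^+ n) @ \oo --> (0 : R).
  rewrite -(mulr0 (C / (1 - q))); apply: cvgMr; apply: cvg_expr.
  by rewrite ger0_norm.
move=> /cvgrPdist_lt /(_ (e / 2)) -[|N _ qN]; first by rewrite divr_gt0.
have small m : (N <= m)%N -> cnorm (u m - u N) < e / 2.
  move=> Nm; have := qN N (leqnn N); rewrite /= sub0r normrN.
  rewrite ger0_norm ?mulr_ge0 ?invr_ge0 ?exprn_ge0 ?(ltW q1')//.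
  apply: le_lt_trans; rewrite -(subnKC Nm); apply: (le_trans (dist _ _)).
  rewrite [leRHS]mulrAC ler_wpM2r ?invr_ge0 ?(ltW q1')//.
  rewrite -[leRHS]mulr1 ler_wpM2l ?mulr_ge0 ?exprn_ge0//.
  by rewrite gerBl exprn_ge0.
exists N => m n Nm Nn; rewrite -(subrKA (u N)).
apply: (le_lt_trans (cnormD _ _)); rewrite (cnorm_distC (u N)).
by have := small _ Nm; have := small _ Nn; lra.
Qed.

Lemma norm_cvgX0 x : cnorm x < 1 -> norm_cvg (fun n => x ^+ n) 0.
Proof.
move=> x1; apply: (@norm_cvg_squeeze _ _ (fun n => cnorm x ^+ n)) => [n|].
  by rewrite subr0 cnormX.
by apply: cvg_expr; rewrite ger0_norm ?cnorm_ge0.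
Qed.

(** Neumann series: the partial sums converge geometrically, and their products with [1 - x] on
    either side are [1 - x ^+ n]. *)
Lemma unit_1B x : cnorm x < 1 -> 1 - x \is a GRing.unit.
Proof.
move=> x1; pose u n := \sum_(i < n) x ^+ i.
have [l ul] : exists l, norm_cvg u l.
  apply: (@geometric_cvg _ 1 (cnorm x)) => [|n]; first by rewrite cnorm_ge0.
  by rewrite /u big_ord_recr /= addrAC subrr add0r mul1r cnormX.
have lim1 : norm_cvg (fun n => 1 - x ^+ n) 1.
  rewrite -[X in norm_cvg _ X](subr0 1); apply: norm_cvgD (norm_cvg_cst _) _.
  exact/norm_cvgN/norm_cvgX0.
have comm n : (1 - x) * u n = 1 - x ^+ n.
  by rewrite -opprB mulNr -subrX1 opprB.
have comm' n : u n * (1 - x) = 1 - x ^+ n.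
  rewrite -comm; symmetry; apply: commr_sum => i _; apply: commrX.
  by apply/commr_sym/commrB => //; exact: commr1.
apply/unitrP; exists l; split.
  apply: (@norm_cvg_unique (fun n => u n * (1 - x))).
    by apply: norm_cvgM ul (norm_cvg_cst _).
  by rewrite (_ : (fun n => _) = fun n => 1 - x ^+ n)//; apply/funext.
apply: (@norm_cvg_unique (fun n => (1 - x) * u n)).
  by apply: norm_cvgM (norm_cvg_cst _) ul.
by rewrite (_ : (fun n => _) = fun n => 1 - x ^+ n)//; apply/funext.
Qed.

Lemma unit_near x y : x \is a GRing.unit -> cnorm (y - x) * cnorm x^-1 < 1 ->
  y \is a GRing.unit.
Proof.
move=> ux xy; have -> : y = x * (1 - x^-1 * (x - y)).
  by rewrite mulrBr mulr1 mulVKr// opprB addrC subrK.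
rewrite unitrMl ?unit_1B//.
by rewrite (le_lt_trans (cnormM _ _))// mulrC cnorm_distC.
Qed.

Lemma norm_cvg_nonunit u l : norm_cvg u l ->
  (forall n, u n \isn't a GRing.unit) -> l \isn't a GRing.unit.
Proof.
move=> /norm_cvgP ul un; apply/negP => lu.
(* The [+ 1] makes the threshold positive without a lower bound on the norm of [l^-1]. *)
have [|N uN] := ul (cnorm l^-1 + 1)^-1.
  by rewrite invr_gt0 ltr_wpDl ?cnorm_ge0.
apply: (negP (un N)); apply: (unit_near lu).
have lp : 0 < cnorm l^-1 + 1 by rewrite ltr_wpDl ?cnorm_ge0.
have := uN N (leqnn N); rewrite -(ltr_pM2r lp) mulVf ?gt_eqF//.
by apply: le_lt_trans; rewrite ler_wpM2l ?cnorm_ge0 ?lerDl.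
Qed.

Lemma spectrum_norm a (l : R[i]) : spectrum a l -> `|l| <= (cnorm a)%:C.
Proof.
move=> sal; rewrite real_leNgt ?normr_real//; last first.
  by apply: ger0_real; rewrite ler0c cnorm_ge0.
apply/negP => al; apply: (negP sal).
have l0 : l != 0.
  by rewrite -normr_gt0; apply: le_lt_trans al; rewrite ler0c cnorm_ge0.
have -> : a - l%:A = - l *: (1 - l^-1 *: a).
  by rewrite scaleNr scalerBr scalerA divff// scale1r opprB.
rewrite scaler_unit ?unitfE ?oppr_eq0// unit_1B//.
have := cnormZ l^-1 a; rewrite normfV => h.
by rewrite -ltcR h mulrC ltr_pdivrMr ?normr_gt0// mul1r.
Qed.
End Norm.

(** * Square roots and spectra of self-adjoint elements *)

Section SpectralTheory.
Variables (R : realType) (A : cstarAlgType R).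
Implicit Types (a b k x y : A) (q : {poly R}).

Lemma comm_lim (u : nat -> A) l x :
  (forall n, GRing.comm x (u n)) -> norm_cvg u l -> GRing.comm x l.
Proof.
move=> xu ul; apply: (norm_cvg_unique (norm_cvgM (norm_cvg_cst x) ul)).
have -> : (fun n => x * u n) = (fun n => u n * x) by apply/funext.
exact: norm_cvgM (norm_cvg_cst x).
Qed.

Lemma comm_alg x (c : R[i]) : GRing.comm x c%:A.
Proof. by rewrite /GRing.comm -scalerAr -scalerAl mulr1 mul1r. Qed.

Lemma comm_scale x y (c : R[i]) : GRing.comm x y -> GRing.comm x (c *: y).
Proof. by rewrite /GRing.comm -scalerAr -scalerAl => ->. Qed.

Lemma scale_half x : (2^-1)%:C *: (x + x) = x.
Proof.
rewrite scalerDr -scalerDl -rmorphD (_ : _ + _ = 1) ?rmorph1 ?scale1r//.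
by field.
Qed.

(* The limit w of the contraction w := (x + w^2)/2 satisfies (1 - w)^2 = 1 - x. *)
Lemma sqrt_1B x : star x = x -> cnorm x < 1 ->
  exists y, [/\ star y = y, y ^+ 2 = 1 - x &
    forall c, GRing.comm c x -> GRing.comm c y].
Proof.
move=> sx x1; pose w := fix w n := if n is m.+1 then
  (2^-1)%:C *: (x + w m ^+ 2) else 0 : A.
have x0 := cnorm_ge0 x.
have wx n : cnorm (w n) <= cnorm x.
  elim: n => [|n IH] /=; first by rewrite cnorm0.
  rewrite cnormZr ger0_norm ?invr_ge0//.
  have := cnormD x (w n ^+ 2); have := cnormX (w n) 2.
  have : cnorm (w n) ^+ 2 <= cnorm x.
    by rewrite expr2; have := cnorm_ge0 (w n); nra.
  by lra.
have ws n : star (w n) = w n.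
  elim: n => [|n IH] /=; first exact: star0.
  by rewrite starZr starD sx star_sqr_sa.
(* The iterates stay in the ball of radius [cnorm x]. Writing the difference of two squares as v (v
   - w) + (v - w) w and halving, consecutive differences shrink by the ratio [cnorm x]. *)
have [l wl] : exists l, norm_cvg w l.
  apply: (@geometric_cvg _ _ _ (cnorm (w 1%N)) (cnorm x)) => [|n]; first by rewrite x0.
  elim: n => [|n IH]; first by rewrite expr0 mulr1 /= subr0.
  rewrite [w n.+2]/= [X in _ - X]/= -scalerBr cnormZr ger0_norm ?invr_ge0//.
  have -> : x + w n.+1 ^+ 2 - (x + w n ^+ 2) =
      w n.+1 * (w n.+1 - w n) + (w n.+1 - w n) * w n.
    by rewrite !expr2 mulrBl mulrBr subrKA opprD addrACA subrr add0r.
  rewrite exprS mulrCA; set d := w n.+1 - w n in IH *.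
  have d0 := cnorm_ge0 d.
  have : cnorm x * cnorm d <= cnorm x * (cnorm (w 1%N) * cnorm x ^+ n).
    by rewrite ler_wpM2l.
  have := cnormD (w n.+1 * d) (d * w n).
  have := cnormM (w n.+1) d; have := cnormM d (w n).
  have : cnorm (w n.+1) * cnorm d <= cnorm x * cnorm d by rewrite ler_wpM2r.
  have : cnorm d * cnorm (w n) <= cnorm x * cnorm d by rewrite mulrC ler_wpM2r.
  by lra.
have ls : star l = l.
  apply: (norm_cvg_unique (norm_cvg_star wl)).
  by rewrite (_ : (fun n => _) = w)//; apply/funext.
have lE : l = (2^-1)%:C *: (x + l ^+ 2).
  have wl1 : norm_cvg (fun n => w n.+1) l.
    apply/norm_cvgP => e e0; have [N Nw] := (norm_cvgP w l).1 wl e e0.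
    by exists N => n Nn; apply: Nw; rewrite leqW.
  apply: (norm_cvg_unique wl1).
  have := norm_cvgM (norm_cvg_cst (2^-1)%:C%:A)
    (norm_cvgD (norm_cvg_cst x) (norm_cvgM wl wl)).
  rewrite -scalerAl mul1r -expr2.
  by rewrite (_ : (fun n => _) = (fun n => w n.+1))//; apply/funext => n /=;
    rewrite -scalerAl mul1r -expr2.
exists (1 - l); split=> [||c cx].
- by rewrite starB star1 ls.
- rewrite expr2 mulrBr mulr1 mulrBl mul1r opprB addrA -expr2.
  have -> : x = l + l - l ^+ 2.
    by apply/eqP; rewrite eq_sym subr_eq [in X in X == _]lE -scalerDr scale_half.
  by rewrite opprB opprD !addrA; congr (_ - _); rewrite addrAC.
- have cw n : GRing.comm c (w n).
    elim: n => [|n IH] /=; first exact: commr0.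
    by apply: comm_scale; apply: commrD => //; apply: commrX.
  by apply: commrB; [exact: commr1|exact: comm_lim wl].
Qed.

Lemma sqrt_CB (c : R) x : star x = x -> cnorm x < c ->
  exists y, [/\ star y = y, y ^+ 2 = c%:C%:A - x &
    forall b, GRing.comm b x -> GRing.comm b y].
Proof.
move=> sx xc; have c0 : 0 < c by apply: le_lt_trans xc; exact: cnorm_ge0.
have [||y [sy y2 yc]] := @sqrt_1B ((c^-1)%:C *: x).
- by rewrite starZr sx.
- by rewrite cnormZr ger0_norm ?invr_ge0 ?ltW// mulrC ltr_pdivrMr ?mul1r.
exists ((Num.sqrt c)%:C *: y); split=> [||b bx].
- by rewrite starZr sy.
- rewrite exprZn y2 -rmorphXn sqr_sqrtr ?ltW//= scalerBr scalerA -rmorphM.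
  by rewrite divff ?gt_eqF// rmorph1 scale1r.
- by apply/comm_scale/yc/comm_scale.
Qed.

(** This takes the place of monotonicity of the norm on positive elements: x^2 + y^2 is [star z * z]
    for z = x + iy, and x, the real part of z, has norm at most that of z. *)
Lemma sqr_cnorm_le_sum x y : star x = x -> star y = y -> GRing.comm x y ->
  cnorm x ^+ 2 <= cnorm (x ^+ 2 + y ^+ 2).
Proof.
move=> sx sy xy; pose z := x + 'i *: y.
have sz : star z = x - 'i *: y.
  by rewrite starD starZ sx sy -scaleNr; congr (_ + _ *: _); apply/eqP;
    rewrite eq_complex /= oppr0 !eqxx.
have -> : x ^+ 2 + y ^+ 2 = star z * z.
  rewrite sz mulrBl !mulrDr -!scalerAr -!scalerAl scalerA.
  have -> : 'i * 'i = -1 :> R[i].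
    by apply/eqP; rewrite eq_complex /=; apply/andP; split; apply/eqP; ring.
  by rewrite scaleN1r xy opprD opprK addrA addrK -!expr2.
rewrite cnorm_star ler_sqr ?nnegrE ?cnorm_ge0//.
have -> : x = (2^-1)%:C *: (z + star z).
  by rewrite sz addrACA subrr addr0 scale_half.
rewrite cnormZr ger0_norm ?invr_ge0//.
by have := cnormD z (star z); rewrite cnorm_starE; lra.
Qed.

Lemma star_inv x : x \is a GRing.unit -> star x^-1 = (star x)^-1.
Proof.
move=> ux; have sxV : star x * star x^-1 = 1 by rewrite -starM mulVr ?star1.
have usx : star x \is a GRing.unit.
  by apply/unitrP; exists (star x^-1); rewrite sxV -starM divrr ?star1.
by apply: (mulrI usx); rewrite sxV divrr.
Qed.

(* If neither endpoint is in the spectrum, then p := |k|^2 - k^2 is invertible and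
   stays a square s^2 after subtracting a small d > 0; then s^2 + k^2 = |k|^2 - d
   contradicts |k|^2 <= |s^2 + k^2|. *)
Lemma cnorm_spectrum_sa k : star k = k ->
  spectrum k (cnorm k)%:C \/ spectrum k (- cnorm k)%:C.
Proof.
move=> sk; apply: contrapT => /not_orP[/negP + /negP]; rewrite !negbK.
set c := cnorm k => uk1 uk2; pose N := c ^+ 2; pose p := N%:C%:A - k ^+ 2.
have k2N : cnorm (k ^+ 2) = N by rewrite cnorm_sqr_sa.
have N0 : 0 <= N by rewrite sqr_ge0.
have sk2 : star (k ^+ 2) = k ^+ 2 by rewrite star_sqr_sa.
have up : p \is a GRing.unit.
  have -> : p = - (k - c%:C%:A) * (k - (- c)%:C%:A).
    rewrite rmorphN scaleNr opprK opprB mulrDr !mulrBl.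
    rewrite -!scalerAl -!scalerAr !mul1r mulr1 scalerA -rmorphM -!expr2.
    by rewrite addrC subrKA.
  by rewrite unitrMl// unitrN.
have p0 : p^-1 != 0 by rewrite invr_eq0; apply: contraTneq up => ->; rewrite unitr0.
pose Q := cnorm p^-1; have Q0 : 0 < Q by exact: cnorm_gt0.
(* With d |p^-1| = 1/4, the element p + d is invertible by a Neumann series, and 2d |(p + d)^-1| is
   at most 2/3. *)
pose d := (4 * Q)^-1; have d0 : 0 < d by rewrite invr_gt0 mulr_gt0.
have dQ : d * Q = 4^-1 by rewrite /d; field; rewrite gt_eqF.
(* From 1 <= |p| Q <= 2 N Q and d Q = 1/4. It makes N - d the norm of the scalar N - d at the
   end. *)
have dN : d <= N.
  have : 1 <= 2 * N * Q.
    have : 1 <= cnorm p * Q by rewrite -(cnorm1 A) -(divrr up) cnormM.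
    move=> /le_trans; apply; apply: ler_wpM2r; first exact: ltW.
    apply: (le_trans (cnormB _ _)).
    by rewrite cnormCr k2N ger0_norm//; lra.
  rewrite -[d <= N](ler_pM2r Q0) dQ; lra.
(* The square root of p itself is out of reach, since [sqrt_CB] asks for a strict bound and |k^2| =
   N. Raising N to N + d gives w with w^2 = p + d; multiplying by a root u of 1 - 2d (p + d)^-1 then
   gives (w u)^2 = p - d. *)
pose pd := p + d%:C%:A.
have upd : pd \is a GRing.unit.
  have -> : pd = p * (1 - (- d)%:C *: p^-1).
    by rewrite rmorphN scaleNr opprK mulrDr mulr1 -scalerAr divrr.
  rewrite unitrMl// unit_1B// cnormZr normrN gtr0_norm// -/Q dQ.
  by rewrite invf_lt1 ?ltr1n.
have [||w [sw w2 wc]] := @sqrt_CB (N + d) (k ^+ 2) => //.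
  by rewrite k2N ltrDl.
have {}w2 : w ^+ 2 = pd by rewrite w2 rmorphD scalerDl /pd /p addrAC.
have spd : star pd = pd by rewrite -w2 star_sqr_sa.
pose y := pd^-1; have sy : star y = y by rewrite star_inv ?spd.
(* The resolvent identity y = p^-1 - d y p^-1 gives |y| <= Q + |y| / 4. *)
have ny : 3 * cnorm y <= 4 * Q.
  have yE : y = p^-1 - d%:C *: (y * p^-1).
    apply: (mulIr up); rewrite mulrBl mulVr// -scalerAl mulrVK//.
    have : y * pd = 1 by rewrite mulVr.
    by rewrite mulrDr -scalerAr mulr1 => <-; rewrite addrK.
  have := cnormB p^-1 (d%:C *: (y * p^-1)); rewrite -yE cnormZr gtr0_norm// -/Q.
  have := cnormM y p^-1; rewrite -/Q -(ler_pM2l d0).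
  have -> : d * (cnorm y * Q) = cnorm y / 4 by rewrite mulrCA dQ.
  by lra.
have [||u [su u2 uc]] := @sqrt_1B ((2 * d)%:C *: y).
- by rewrite starZr sy.
- rewrite cnormZr gtr0_norm ?mulr_gt0//.
  have : d * (3 * cnorm y) <= d * (4 * Q) by rewrite ler_pM2l.
  by rewrite (mulrCA d 4) dQ; lra.
have cy b : GRing.comm b w -> GRing.comm b y.
  by move=> bw; apply: commrV; rewrite -w2; apply: commrX.
have kw : GRing.comm k w by apply: wc; apply: commrX.
have wu : GRing.comm w u by apply/uc/comm_scale/cy.
have ku : GRing.comm k u by apply/uc/comm_scale/cy.
have := @sqr_cnorm_le_sum k (w * u) sk.
rewrite starM sw su => /(_ (esym wu) (commrM kw ku)).
have -> : k ^+ 2 + (w * u) ^+ 2 = (N - d)%:C%:A.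
  rewrite exprMn_comm// w2 u2 mulrBr mulr1 -scalerAr divrr// /pd /p.
  rewrite addrA addrA addrCA subrr addr0.
  by rewrite -addrA -scalerBl -rmorphB -scalerDl -rmorphD; congr (_%:C%:A); lra.
by rewrite cnormCr ger0_norm ?subr_ge0// -/c -/N; lra.
Qed.

(* If l is in the spectrum of a, then |l + in| <= |a + in| for every real n, which is
   impossible for large |n| unless l is real. *)
Lemma spectrum_real a (l : R[i]) : star a = a -> spectrum a l -> l = (complex.Re l)%:C.
Proof.
move=> sa sal; case: l => s t in sal *; rewrite /=.
apply/eqP; rewrite eq_complex /= eqxx /=; apply/eqP; apply: contrapT => /eqP t0.
have bound (n : R) : s ^+ 2 + (t + n) ^+ 2 <= cnorm a ^+ 2 + n ^+ 2.
  pose c : R[i] := (0 +i* n)%C; pose z := a + c%:A.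
  have szl : spectrum z (s +i* (t + n))%C.
    move: sal; rewrite /spectrum /=; congr (~~ (_ \is a _)).
    rewrite /z -addrA; congr (_ + _); rewrite -scalerBl -scaleNr; congr (_ *: _).
    by apply/eqP; rewrite eq_complex /=; apply/andP; split; apply/eqP; ring.
  have := spectrum_norm szl; rewrite normc_def /= lecR.
  have : cnorm z ^+ 2 <= cnorm a ^+ 2 + n ^+ 2.
    rewrite -cnorm_star (_ : star z * z = a ^+ 2 + (n ^+ 2)%:C%:A); last first.
      have -> : star z = a - c%:A.
        rewrite starD starZ star1 sa -scaleNr; congr (_ + _ *: _).
        by apply/eqP; rewrite eq_complex /= oppr0 !eqxx.
      rewrite mulrDr !mulrBl (comm_alg a c) addrA subrK; congr (_ + _).
      rewrite -scalerAl mul1r scalerA -scaleNr; congr (_ *: _).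
      by apply/eqP; rewrite eq_complex /=; apply/andP; split; apply/eqP; ring.
    apply: (le_trans (cnormD _ _)).
    by rewrite cnorm_sqr_sa// cnormCr ger0_norm ?sqr_ge0.
  move=> zn zs; apply: le_trans zn.
  rewrite -(@sqr_sqrtr _ (s ^+ 2 + (t + n) ^+ 2)) ?addr_ge0 ?sqr_ge0//.
  by rewrite ler_sqr ?nnegrE ?cnorm_ge0 ?sqrtr_ge0.
(* The n^2 on both sides of [bound] cancel, leaving s^2 + t^2 + 2tn <= |a|^2; this n makes 2tn equal
   to |a|^2 + 1. *)
have := bound ((cnorm a ^+ 2 + 1) / (2 * t)).
set n := _ / _.
have : 2 * t * n = cnorm a ^+ 2 + 1 by rewrite /n; field.
by have := sqr_ge0 s; have := sqr_ge0 t; rewrite sqrrD; lra.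
Qed.
End SpectralTheory.

(** * Real polynomials in an element: spectral mapping and norm estimate *)

Section PolynomialCalculus.
Variables (R : realType) (A : cstarAlgType R).
Implicit Types (a b k x y : A) (p q : {poly R}).

Definition peval a q : A := horner_alg a (map_poly (real_complex R) q).

Lemma pevalC a (c : R) : peval a c%:P = c%:C%:A.
Proof. by rewrite /peval map_polyC horner_algC. Qed.

Lemma pevalX a : peval a 'X = a.
Proof. by rewrite /peval map_polyX horner_algX. Qed.

Lemma pevalD a p q : peval a (p + q) = peval a p + peval a q.
Proof. by rewrite /peval !rmorphD. Qed.

Lemma pevalB a p q : peval a (p - q) = peval a p - peval a q.
Proof. by rewrite /peval !rmorphB. Qed.

Lemma pevalM a p q : peval a (p * q) = peval a p * peval a q.
Proof. by rewrite /peval !rmorphM. Qed.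

Lemma pevalXn a n : peval a ('X^n) = a ^+ n.
Proof. by rewrite /peval map_polyXn rmorphXn /= horner_algX. Qed.

Lemma pevalZ a (c : R) q : peval a (c *: q) = c%:C *: peval a q.
Proof. by rewrite -mul_polyC pevalM pevalC -scalerAl mul1r. Qed.

Lemma peval_comm a p q : GRing.comm (peval a p) (peval a q).
Proof. by rewrite /GRing.comm -!pevalM mulrC. Qed.

Lemma peval_star a q : star a = a -> star (peval a q) = peval a q.
Proof.
move=> sa; elim/poly_ind: q => [|q c IH].
  by rewrite /peval !rmorph0 star0.
rewrite pevalD pevalM pevalX pevalC starD starM starC IH sa; congr (_ + _).
by have := peval_comm a 'X q; rewrite pevalX.
Qed.

Lemma spectrum_peval a q (t : R) :
  spectrum a t%:C -> spectrum (peval a q) (q.[t])%:C.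
Proof.
rewrite /spectrum /= => at_; have /factor_theorem[r rE] : root (q - (q.[t])%:P) t.
  by rewrite /root !hornerE subrr.
rewrite -(pevalC a) -pevalB rE pevalM unitrM_comm; last exact: peval_comm.
by rewrite negb_and pevalB pevalX pevalC at_ orbT.
Qed.

Lemma unit_prod_seq (s : seq A) :
  all (fun x => x \is a GRing.unit) s -> \prod_(x <- s) x \is a GRing.unit.
Proof.
elim: s => [|x s IH] /=; first by rewrite big_nil unitr1.
by move=> /andP[ux us]; rewrite big_cons unitrMl// IH.
Qed.

(** Over the complex numbers q - m splits into linear factors. If every a - z were invertible, so
    would be their product; a root z with a - z singular lies in the spectrum of a, hence is
    real. *)
Lemma peval_spectrum a q (m : R) : star a = a -> spectrum (peval a q) m%:C ->
  exists2 t, spectrum a t%:C & q.[t] = m.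
Proof.
rewrite /spectrum /= -(pevalC a) -pevalB => sa; set p := q - _ => pa.
pose P : {poly R[i]} := map_poly (real_complex R) p.
(* When q is the constant m any spectral point will do, and one of the two points plus or minus |a|
   is spectral. *)
have [p0|p0] := eqVneq p 0.
  have qE : q = m%:P by apply/eqP; rewrite -subr_eq0; apply/eqP.
  by case: (cnorm_spectrum_sa sa) => h; eexists; try exact: h; rewrite qE hornerC.
have P0 : P != 0 by rewrite map_poly_eq0.
have [s PE] := closed_field_poly_normal P.
have [z zs za] : exists2 z, z \in s & a - z%:A \isn't a GRing.unit.
  apply: contrapT => none; apply: (negP pa); rewrite /peval -/P PE.
  rewrite -mul_polyC rmorphM /= horner_algC -scalerAl mul1r.
  rewrite scaler_unit ?unitfE ?lead_coef_eq0// rmorph_prod /=.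
  rewrite -(big_map (fun z => horner_alg a ('X - z%:P)) xpredT id) unit_prod_seq//.
  rewrite all_map; apply/allP => z zs /=; rewrite rmorphB /= horner_algX horner_algC.
  by apply/negPn/negP => uz; apply: none; exists z.
have zE := spectrum_real sa za; exists (complex.Re z).
  by rewrite /= -zE.
have : root P z by rewrite PE rootZ ?lead_coef_eq0// root_prod_XsubC.
rewrite zE /root horner_map /= => /eqP /complexI.
by rewrite /p !hornerE => /eqP; rewrite subr_eq0 => /eqP.
Qed.

(** The norm of the self-adjoint element q(a) is, up to sign, in its spectrum, hence up to sign a
    value of q on the spectrum of a. This estimate carries convergence of polynomials on the
    spectrum over to convergence in [A]. *)
Lemma peval_norm_le a q (M : R) : star a = a ->
  (forall t, spectrum a t%:C -> `|q.[t]| <= M) -> cnorm (peval a q) <= M.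
Proof.
move=> sa qM; have n0 := cnorm_ge0 (peval a q).
case: (cnorm_spectrum_sa (peval_star q sa)) => /(peval_spectrum sa)[t st tE].
  by have := qM t st; rewrite tE ger0_norm.
by have := qM t st; rewrite tE normrN ger0_norm.
Qed.

Lemma spectrum_itv a (t : R) : spectrum a t%:C -> - cnorm a <= t <= cnorm a.
Proof.
move=> /spectrum_norm; rewrite normc_def /= expr0n addr0 sqrtr_sqr lecR.
by rewrite ler_norml.
Qed.

Lemma cnorm_spectrum0 a : star a = a ->
  (forall t, spectrum a t%:C -> t = 0) -> a = 0.
Proof.
move=> sa a0; apply/cnorm_eq0; case: (cnorm_spectrum_sa sa) => /a0//.
by move=> /eqP; rewrite oppr_eq0 => /eqP.
Qed.

End PolynomialCalculus.

(** * Weierstrass approximation by Bernstein polynomials *)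

Section Weierstrass.
Variable R : realType.
Implicit Types (f : R -> R) (t u : R) (g h : nat -> R) (U : {poly R}).

(* The n-th Bernstein polynomial, with g k the value at the k-th node and U the
   affine map of the interval onto [0, 1]; the recursion is Pascal's rule. *)
Fixpoint bernstein U n g : {poly R} :=
  if n is m.+1 then
    (1 - U) * bernstein U m g + U * bernstein U m (fun k => g k.+1)
  else (g 0%N)%:P.

Lemma bernsteinS U n g t : (bernstein U n.+1 g).[t] =
  (1 - U.[t]) * (bernstein U n g).[t] +
  U.[t] * (bernstein U n (fun k => g k.+1)).[t].
Proof. by rewrite /= !hornerE. Qed.

Lemma bernstein_le U n g h t : 0 <= U.[t] <= 1 ->
  (forall k, (k <= n)%N -> g k <= h k) ->
  (bernstein U n g).[t] <= (bernstein U n h).[t].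
Proof.
move=> /andP[u0 u1]; elim: n g h => [|n IH] g h gh; first by rewrite !hornerC gh.
rewrite !bernsteinS lerD// ler_wpM2l// ?subr_ge0//; apply: IH => k kn; apply: gh => //.
exact: leqW.
Qed.

(** Variance plus squared bias of a binomial variable. The centre [c] is arbitrary because Pascal's
    rule shifts the nodes by one, which replaces [c] by [c - 1] in the induction. *)
Lemma bernstein_sqr U n t (x y c : R) :
  (bernstein U n (fun k => x + y * (k%:R - c) ^+ 2)).[t] =
  x + y * (n%:R * U.[t] * (1 - U.[t]) + (n%:R * U.[t] - c) ^+ 2).
Proof.
elim: n c => [|n IH] c; first by rewrite hornerC; ring.
rewrite bernsteinS IH.
rewrite (_ : (fun k => _) = fun k : nat => x + y * (k%:R - (c - 1)) ^+ 2).
  by rewrite IH -natr1; ring.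
by apply/funext => k; rewrite -natr1; ring.
Qed.

Lemma itv_unif_continuous f (a b : R) :
  (forall t, a <= t <= b -> {for t, continuous f}) ->
  forall e : R, 0 < e -> exists2 d : R, 0 < d &
    forall s t, a <= s <= b -> `|s - t| < d -> `|f s - f t| < e.
Proof.
move=> fc e e0.
have cK := @segment_compact R a b.
pose P (d s : R) := forall t, `|s - t| < d -> `|f s - f t| < e.
have cov x : `[a, b]%classic x -> \forall s \near x & d \near (0 : R)^'+, P d s.
  rewrite /= in_itv /= => xab.
  have /cvgrPdist_lt/(_ (e / 2)) := fc _ xab.
  rewrite divr_gt0// => /(_ isT) /nbhs_ballP[r /= r0 rf].
  near=> s d; rewrite /P /= => t st.
  (* Half the radius for each of x - s and s - t keeps both s and t within r of x; t itself may
     leave the interval. *)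
  have xs : `|x - s| < r / 2.
    by near: s; apply/nbhs_ballP; exists (r / 2) => //=; rewrite divr_gt0.
  have dr : d < r / 2.
    by near: d; apply: nbhs_right_lt; rewrite divr_gt0.
  have := rf s; have := rf t; rewrite /= /ball /=.
  have : `|x - t| <= `|x - s| + `|s - t|.
    by rewrite -(subrKA s) ler_normD.
  have -> : f s - f t = (f x - f t) - (f x - f s) by ring.
  have := ler_normB (f x - f t) (f x - f s).
  move=> h1 h2 /(_ _) h3 /(_ _) h4.
  have hs : `|x - s| < r by lra.
  have ht : `|x - t| < r by lra.
  by have := h4 hs; have := h3 ht; lra.
have dP0 : \forall d \near (0 : R)^'+, `[a, b]%classic `<=` P d.
  exact: ((compact_near_coveringP _).1 cK R _ P _ cov).
have /filter_ex[d [d0 dP]] : \forall d \near (0 : R)^'+,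
    0 < d /\ `[a, b]%classic `<=` P d.
  by apply: filterI dP0; exact: nbhs_right_gt.
exists d => // s t sab; apply: dP.
by rewrite /= in_itv.
Unshelve. all: by end_near. Qed.

Lemma itv_bounded f (a b : R) :
  (forall t, a <= t <= b -> {for t, continuous f}) ->
  exists M : R, forall t, a <= t <= b -> `|f t| <= M.
Proof.
move=> fc; have cK := @segment_compact R a b.
pose P (M s : R) := `|f s| <= M.
have cov x : `[a, b]%classic x -> \forall s \near x & M \near +oo%R, P M s.
  rewrite /= in_itv /= => xab.
  have /cvgrPdist_lt/(_ 1) := fc _ xab.
  rewrite ltr01 => /(_ isT) fx.
  near=> s M.
  have : `|f x - f s| < 1 by near: s.
  have : `|f x| + 1 <= M by near: M; apply: nbhs_pinfty_ge; rewrite num_real.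
  have := ler_normB (f x) (f x - f s); rewrite subKr /P /=; lra.
have /filter_ex[M MP] : \forall M \near +oo%R, `[a, b]%classic `<=` P M.
  exact: ((compact_near_coveringP _).1 cK R _ P _ cov).
exists M => t tab; apply: MP.
by rewrite /= in_itv.
Unshelve. all: by end_near. Qed.

Lemma weierstrass f (a b : R) : a < b ->
  (forall t, a <= t <= b -> {for t, continuous f}) ->
  forall e : R, 0 < e -> exists q : {poly R},
    forall t, a <= t <= b -> `|q.[t] - f t| < e.
Proof.
move=> ab fc e e0; have [M fM] := itv_bounded fc.
have [|d d0 fd] := itv_unif_continuous fc (e := e / 2); first by rewrite divr_gt0.
have M0 : 0 <= M by apply: le_trans (normr_ge0 (f a)) _; apply: fM; rewrite lexx ltW.
pose w := b - a; have w0 : 0 < w by rewrite subr_gt0.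
(* At distance d or more, |f s - f t| <= 2M <= C (s - t)^2; closer, it is below e/2. The sum of the
   two bounds covers both cases. *)
pose C := 2 * M / d ^+ 2; have C0 : 0 <= C.
  by apply: divr_ge0; [exact: mulr_ge0|exact: sqr_ge0].
have close s t : a <= s <= b -> a <= t <= b -> `|f s - f t| <= e / 2 + C * (s - t) ^+ 2.
  move=> sab tab; have [/(fd _ _ sab)|dst] := ltP `|s - t| d.
    by have := mulr_ge0 C0 (sqr_ge0 (s - t)); lra.
  have : 2 * M <= C * (s - t) ^+ 2.
    rewrite /C mulrAC ler_pdivlMr ?exprn_gt0// ler_wpM2l ?mulr_ge0//.
    by rewrite -[leRHS]real_normK ?num_real// ler_sqr ?nnegrE// ltW.
  have := ler_normB (f s) (f t); have := fM _ sab; have := fM _ tab; lra.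
(* The variance term is C w^2 / n times u (1 - u), with u the value of [U] in [0, 1]; this n brings
   it below e/2. *)
pose n := (Num.truncn (C * w ^+ 2 / (e / 2))).+1.
have nC : C * w ^+ 2 / n%:R < e / 2.
  rewrite ltr_pdivrMr ?ltr0n// -ltr_pdivrMl ?divr_gt0// mulrC.
  exact: truncnS_gt.
have n0 : 0 < n%:R :> R by rewrite ltr0n.
pose U : {poly R} := w^-1 *: ('X - a%:P).
pose x (k : nat) := a + w * (k%:R / n%:R).
exists (bernstein U n (f \o x)) => t tab.
have Ut : U.[t] = (t - a) / w by rewrite !hornerE mulrC.
have u01 : 0 <= U.[t] <= 1.
  case/andP: tab => at_ tb; rewrite Ut ler_pdivrMr// mul1r /w lerB// andbT.
  by apply: divr_ge0; [rewrite subr_ge0|exact: ltW].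
have tE : t = a + w * U.[t] by rewrite Ut; field; rewrite gt_eqF.
have xab k : (k <= n)%N -> a <= x k <= b.
  move=> kn; have k0 : 0 <= k%:R / n%:R :> R by rewrite divr_ge0.
  have k1 : k%:R / n%:R <= 1 :> R by rewrite ler_pdivrMr// mul1r ler_nat.
  by rewrite /x; apply/andP; split; rewrite /w in w0 *; nra.
pose K := C * w ^+ 2 / n%:R ^+ 2; pose c := n%:R * U.[t].
have dist k : (k <= n)%N -> `|f (x k) - f t| <= e / 2 + K * (k%:R - c) ^+ 2.
  move=> kn; have := close _ _ (xab k kn) tab.
  by rewrite {2}tE /x /K /c; congr (_ <= _ + _); field; rewrite gt_eqF.
have small : K * (n%:R * U.[t] * (1 - U.[t]) + (n%:R * U.[t] - c) ^+ 2) < e / 2.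
  apply: le_lt_trans nC.
  have -> : K * (n%:R * U.[t] * (1 - U.[t]) + (n%:R * U.[t] - c) ^+ 2) =
      C * w ^+ 2 / n%:R * (U.[t] * (1 - U.[t])) by rewrite /K /c; field; rewrite gt_eqF.
  rewrite -[leRHS]mulr1; apply: ler_wpM2l; last by case/andP: u01 => ? ?; nra.
  by apply: divr_ge0; [apply: mulr_ge0 => //; exact: sqr_ge0|exact: ltW].
(* At the nodes f lies between two quadratics centred at t, whose Bernstein polynomials are known
   exactly; monotonicity transfers the enclosure. *)
have lo := @bernstein_le U n
  (fun k => (f t - e / 2) + (- K) * (k%:R - c) ^+ 2) (f \o x) t u01.
have hi := @bernstein_le U n (f \o x)
  (fun k => (f t + e / 2) + K * (k%:R - c) ^+ 2) t u01.
rewrite !bernstein_sqr mulNr in lo hi; move: small lo hi; set y := K * _.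
move=> small lo hi; rewrite ltr_norml; apply/andP; split.
  suff: f t - e / 2 - y <= (bernstein U n (f \o x)).[t] by lra.
  by apply: lo => k kn; have := dist k kn; rewrite ler_norml /= mulNr; lra.
suff: (bernstein U n (f \o x)).[t] <= f t + e / 2 + y by lra.
by apply: hi => k kn; have := dist k kn; rewrite ler_norml /=; lra.
Qed.

End Weierstrass.

(** * The continuous functional calculus *)

Section ContinuousCalculus.
Variables (R : realType) (A : cstarAlgType R).
Implicit Types (a b c : A) (f g : R -> R) (q p : {poly R}).

Lemma uniform_cvgP (S : set R) (u : nat -> R -> R) f :
  {uniform S, u @ \oo --> f} <->
  forall e : R, 0 < e -> exists N, forall n, (N <= n)%N ->
    forall t, S t -> `|u n t - f t| < e.
Proof.
split=> [uf e e0|uf].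
  have : \forall n \near \oo, forall t, S t -> `|u n t - f t| < e.
    apply: (uf [set h : R -> R | forall t, S t -> `|h t - f t| < e]).
    apply/uniform_nbhs; exists [set xy : R * R | ball xy.1 e xy.2]; split.
      by rewrite -entourage_ballE; exists e.
    by move=> h /= hf t St; have := hf t St; rewrite /ball /= distrC.
  by case=> N _ Nu; exists N.
move=> P /uniform_nbhs[E [entE EP]].
have [e /= e0 eE] : exists2 e : R, 0 < e & [set xy : R * R | ball xy.1 e xy.2] `<=` E.
  by move: entE; rewrite -entourage_ballE => -[e /= e0 eE]; exists e.
have [N Nu] := uf e e0; exists N => // n /= Nn.
by apply: EP => t St; apply: eE; rewrite /ball /= distrC Nu.
Qed.

(** One polynomial per tolerance is easier to combine than sequences; a choice at the tolerances
    1/(n+1) recovers the sequence. *)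
Lemma is_cfcP f a b : is_cfc f a b <-> star a = a /\
  forall e : R, 0 < e -> exists q,
    (forall t, spectrum a t%:C -> `|q.[t] - f t| <= e) /\
    cnorm (peval a q - b) <= e.
Proof.
split=> [[sa [q /uniform_cvgP qf /norm_cvgP qb]]|[sa fab]]; split=> //.
  move=> e e0; have [N Nf] := qf e e0; have [M Mb] := qb e e0.
  exists (q (maxn N M)); split=> [t st|].
    by apply/ltW/Nf; first exact: leq_maxl.
  by apply/ltW/Mb; exact: leq_maxr.
have inv0 (n : nat) : 0 < n.+1%:R^-1 :> R by rewrite invr_gt0.
have /choice[q qP] : forall n : nat, exists q,
    (forall t, spectrum a t%:C -> `|q.[t] - f t| <= n.+1%:R^-1) /\
    cnorm (peval a q - b) <= n.+1%:R^-1 by move=> n; apply: fab.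
have cvg0 := @cvg_harmonic R.
exists q.
  apply/uniform_cvgP => e e0; have /cvgrPdist_lt /(_ e e0) [N _ Nh] := cvg0.
  exists N => n Nn t st; apply: le_lt_trans ((qP n).1 t st) _.
  by have := Nh n Nn; rewrite /= sub0r normrN gtr0_norm.
by apply: norm_cvg_squeeze cvg0 => n; exact: (qP n).2.
Qed.

Lemma is_cfc_sa f a b : is_cfc f a b -> star a = a.
Proof. by case. Qed.

Lemma is_cfc_star f a b : is_cfc f a b -> star b = b.
Proof.
move=> /is_cfcP[sa fab]; apply/eqP; rewrite -subr_eq0; apply/eqP/cnorm_eq0/le_anti.
rewrite cnorm_ge0 andbT; apply/ler_addgt0Pr => e e0; rewrite add0r.
have [|q [_ qb]] := fab (e / 2); first by rewrite divr_gt0.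
have -> : star b - b = peval a q - b - star (peval a q - b).
  by rewrite starB peval_star// opprB [RHS]addrC subrKA.
by apply: (le_trans (cnormB _ _)); rewrite cnorm_starE; lra.
Qed.

Lemma is_cfc_norm f a b (M : R) : is_cfc f a b ->
  (forall t, spectrum a t%:C -> `|f t| <= M) -> cnorm b <= M.
Proof.
move=> /is_cfcP[sa fab] fM; apply/ler_addgt0Pr => e e0.
have [|q [qf qb]] := fab (e / 2); first by rewrite divr_gt0.
have : cnorm (peval a q) <= M + e / 2.
  apply: peval_norm_le => // t st; have := fM t st; have := qf t st.
  by have := ler_normD (q.[t] - f t) (f t); rewrite subrK; lra.
have := cnormB (peval a q) (peval a q - b); rewrite opprB addrC subrK; lra.
Qed.

Lemma eq_is_cfc f g a b :
  (forall t, spectrum a t%:C -> f t = g t) -> is_cfc f a b -> is_cfc g a b.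
Proof.
move=> fg /is_cfcP[sa fab]; apply/is_cfcP; split=> // e e0.
have [q [qf qb]] := fab e e0; exists q; split=> // t st.
by rewrite -fg// qf.
Qed.

Lemma is_cfc_poly q a : star a = a -> is_cfc (fun t => q.[t]) a (peval a q).
Proof.
move=> sa; apply/is_cfcP; split=> // e e0; exists q; split=> [t st|].
  by rewrite subrr normr0 ltW.
by rewrite subrr cnorm0 ltW.
Qed.

Lemma is_cfc_cst (k : R) a : star a = a -> is_cfc (fun=> k) a k%:C%:A.
Proof.
move=> sa; rewrite -(pevalC a); apply: eq_is_cfc (is_cfc_poly k%:P sa) => t _.
by rewrite hornerC.
Qed.

Lemma is_cfc1 a : star a = a -> is_cfc (fun=> 1) a 1.
Proof. by move=> sa; have := is_cfc_cst 1 sa; rewrite rmorph1 scale1r. Qed.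

Lemma is_cfc_id a : star a = a -> is_cfc id a a.
Proof.
move=> sa; rewrite -{2}(pevalX a); apply: eq_is_cfc (is_cfc_poly 'X sa) => t _.
by rewrite hornerX.
Qed.

Lemma is_cfcD f g a b c : is_cfc f a b -> is_cfc g a c ->
  is_cfc (fun t => f t + g t) a (b + c).
Proof.
move=> /is_cfcP[sa fab] /is_cfcP[_ gac]; apply/is_cfcP; split=> // e e0.
have e2 : 0 < e / 2 by rewrite divr_gt0.
have [q [qf qb]] := fab _ e2; have [p [pg pc]] := gac _ e2.
exists (q + p); split=> [t st|].
  rewrite hornerD opprD addrACA; apply: (le_trans (ler_normD _ _)).
  by have := qf t st; have := pg t st; lra.
rewrite pevalD opprD addrACA; apply: (le_trans (cnormD _ _)); lra.
Qed.

(** The elements q_n(a) - q_n(t) are singular and converge to b - f(t), and singular elements form a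
    closed set. *)
Lemma is_cfc_spectrum f a b (t : R) : is_cfc f a b ->
  spectrum a t%:C -> spectrum b (f t)%:C.
Proof.
move=> [sa [q /uniform_cvgP qf qb]] st.
apply: (@norm_cvg_nonunit _ _ (fun n => peval a (q n) - (q n).[t]%:C%:A)); last first.
  by move=> n; exact: (spectrum_peval (q n) st).
apply: norm_cvgD qb _; apply: norm_cvgN; apply/norm_cvgP => e e0.
have [N Nf] := qf e e0; exists N => n Nn.
by rewrite -scalerBl -rmorphB cnormCr; exact: Nf.
Qed.

Lemma is_cfc_le f a b (t : R) : is_cfc f a b -> spectrum a t%:C -> `|f t| <= cnorm b.
Proof. by move=> fab /(is_cfc_spectrum fab) /spectrum_itv; rewrite ler_norml. Qed.

Lemma is_cfcM f g a b c : is_cfc f a b -> is_cfc g a c ->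
  is_cfc (fun t => f t * g t) a (b * c).
Proof.
move=> fb gc; have /is_cfcP[sa fab] := fb; have /is_cfcP[_ gac] := gc.
apply/is_cfcP; split=> // e e0; have b0 := cnorm_ge0 b; have c0 := cnorm_ge0 c.
pose K := cnorm b + cnorm c + 1; have K1 : 1 <= K by rewrite lerDr addr_ge0.
(* Both errors are at most d (d + |c|) + |b| d, which is at most d K because d <= 1; [is_cfc_le]
   supplies the bounds of f and g on the spectrum. *)
pose d := Num.min 1 (e / K).
have K0 : 0 < K by lra.
have d0 : 0 < d by rewrite lt_min ltr01 divr_gt0.
have d1 : d <= 1 by rewrite ge_min lexx.
have dK : d * K <= e by rewrite -ler_pdivlMr// ge_min lexx orbT.
have [q [qf qb]] := fab _ d0; have [p [pg pc]] := gac _ d0.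
exists (q * p); split=> [t st|].
  rewrite hornerM; apply: le_trans dK.
  have -> : q.[t] * p.[t] - f t * g t =
      (q.[t] - f t) * p.[t] + f t * (p.[t] - g t) by ring.
  apply: (le_trans (ler_normD _ _)); rewrite !normrM.
  have := ler_normD (p.[t] - g t) (g t); rewrite subrK.
  have := is_cfc_le fb st; have := is_cfc_le gc st.
  have := qf t st; have := pg t st; rewrite /K.
  have := normr_ge0 (q.[t] - f t); have := normr_ge0 (p.[t] - g t).
  have := normr_ge0 (p.[t]); have := normr_ge0 (f t).
  move: `|q.[t] - f t| `|p.[t] - g t| `|p.[t]| `|f t| `|g t| => x y z v w.
  move=> v0 z0 y0 x0 yd xd wc vb zyw.
  have : x * z <= d * (d + cnorm c) by apply: ler_pM => //; lra.
  have : v * y <= cnorm b * d by apply: ler_pM.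
  have : d * d <= d * 1 by rewrite ler_wpM2l// ltW.
  rewrite !mulrDr; lra.
rewrite pevalM; apply: le_trans dK.
have -> : peval a q * peval a p - b * c =
    (peval a q - b) * peval a p + b * (peval a p - c).
  by rewrite mulrBl mulrBr addrA subrK.
apply: (le_trans (cnormD _ _)).
apply: (le_trans (lerD (cnormM _ _) (cnormM _ _))).
have := cnormD (peval a p - c) c; rewrite subrK.
have := cnorm_ge0 (peval a q - b); have := cnorm_ge0 (peval a p - c).
have := cnorm_ge0 (peval a p).
move: (cnorm (peval a q - b)) (cnorm (peval a p - c)) (cnorm (peval a p)) qb pc => x y z xd yd.
move=> z0 y0 x0 zyc.
have : x * z <= d * (d + cnorm c) by apply: ler_pM => //; lra.
have : cnorm b * y <= cnorm b * d by apply: ler_pM.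
have : d * d <= d * 1 by rewrite ler_wpM2l// ltW.
rewrite /K !mulrDr; lra.
Qed.

Lemma is_cfcZ (k : R) f a b : is_cfc f a b -> is_cfc (fun t => k * f t) a (k%:C *: b).
Proof.
move=> fab; rewrite -[b]mul1r scalerAl; apply: (is_cfcM _ fab).
exact: is_cfc_cst (is_cfc_sa fab).
Qed.

Lemma is_cfc_unique f a b c : is_cfc f a b -> is_cfc f a c -> b = c.
Proof.
move=> fb fc; apply/eqP; rewrite -subr_eq0; apply/eqP/cnorm_eq0/le_anti.
rewrite cnorm_ge0 andbT.
have := is_cfcD fb (is_cfcZ (-1) fc); rewrite rmorphN1 scaleN1r => /is_cfc_norm.
by apply=> t _; rewrite mulN1r subrr normr0.
Qed.

Lemma cfc_eq f a b : is_cfc f a b -> cfc f a = b.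
Proof.
move=> fab; apply: (is_cfc_unique _ fab).
by apply: (@xgetPex _ 0 [set b | is_cfc f a b]); exists b.
Qed.

Lemma is_cfc_comm f a b : is_cfc f a b -> GRing.comm a b.
Proof.
move=> fab; have ida := is_cfc_id (is_cfc_sa fab).
apply: (is_cfc_unique (is_cfcM ida fab)).
by apply: eq_is_cfc (is_cfcM fab ida) => t _; rewrite mulrC.
Qed.

Lemma is_cfc_horner q f a b : is_cfc f a b ->
  is_cfc (fun t => q.[f t]) a (peval b q).
Proof.
move=> fab; have sa := is_cfc_sa fab; elim/poly_ind: q => [|q k IH].
  have := is_cfc_cst 0 sa; rewrite -(pevalC b) polyC0.
  by apply: eq_is_cfc => t _; rewrite horner0.
rewrite pevalD pevalM pevalX pevalC.
apply: eq_is_cfc (is_cfcD (is_cfcM IH fab) (is_cfc_cst k sa)) => t _.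
by rewrite !hornerE.
Qed.

(** A polynomial p near g on the spectrum of b is near g at every f(t) with t spectral for a, and
    p(b) is already the calculus of p composed with f at a. *)
Lemma is_cfc_comp f g a b c : is_cfc f a b -> is_cfc g b c -> is_cfc (g \o f) a c.
Proof.
move=> fab /is_cfcP[sb gbc]; apply/is_cfcP; split; first exact: is_cfc_sa fab.
move=> e e0; have e2 : 0 < e / 2 by rewrite divr_gt0.
have [p [pg pc]] := gbc _ e2.
have /is_cfcP[_ /(_ _ e2) [q [qf qb]]] := is_cfc_horner p fab.
exists q; split=> [t st|].
  have := qf t st; have := pg (f t) (is_cfc_spectrum fab st).
  by have := ler_normD (q.[t] - p.[f t]) (p.[f t] - g (f t)); rewrite subrKA /=; lra.
have := cnormD (peval a q - peval b p) (peval b p - c); rewrite subrKA; lra.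
Qed.

(** An interval stands in for the spectrum, so that hypotheses on functions can be stated on a
    segment. *)
Definition spectrum_in a (x y : R) := forall t, spectrum a t%:C -> x <= t <= y.

Lemma is_cfc_lim f a (q : nat -> {poly R}) : star a = a ->
  {uniform [set t : R | spectrum a t%:C],
    (fun (n : nat) (t : R) => (q n).[t]) @ \oo --> f} ->
  exists2 b, is_cfc f a b & norm_cvg (fun n => peval a (q n)) b.
Proof.
move=> sa qf; suff [b qb] : exists b, norm_cvg (fun n => peval a (q n)) b.
  by exists b => //; split=> //; exists q.
apply: cnorm_complete => e e0; have /uniform_cvgP/(_ (e / 4)) := qf.
rewrite divr_gt0// => /(_ isT)[N Nf]; exists N => m n Nm Nn.
rewrite -pevalB; apply: (@le_lt_trans _ _ (e / 2)); last by lra.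
apply: peval_norm_le => // t st; rewrite hornerD hornerN.
have := Nf m Nm t st; have := Nf n Nn t st.
have := ler_normB ((q m).[t] - f t) ((q n).[t] - f t).
by rewrite opprB addrA subrK; lra.
Qed.

Lemma is_cfc_exists f a (x y : R) : star a = a -> spectrum_in a x y ->
  (forall t, x <= t <= y -> {for t, continuous f}) -> exists b, is_cfc f a b.
Proof.
move=> sa axy fc.
have approx (e : R) : 0 < e -> exists q, forall t, x <= t <= y -> `|q.[t] - f t| < e.
  (* [weierstrass] needs a nondegenerate interval; otherwise the interval has at most one point and
     a constant is enough. *)
  move=> e0; have [xy|yx] := ltP x y; first exact: weierstrass.
  exists (f x)%:P => t /andP[xt ty]; rewrite hornerC (_ : x = t) ?subrr ?normr0//.
  lra.
have /choice[q qf] : forall n : nat, exists q,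
    forall t, x <= t <= y -> `|q.[t] - f t| < n.+1%:R^-1.
  by move=> n; apply: approx; rewrite invr_gt0.
have [|b fab _] := @is_cfc_lim f a q sa; last by exists b.
apply/uniform_cvgP => e e0.
have /cvgrPdist_lt /(_ e e0) [N _ Nh] := @cvg_harmonic R.
exists N => n Nn t /axy txy; apply: lt_trans (qf n t txy) _.
by have := Nh n Nn; rewrite /= sub0r normrN gtr0_norm ?invr_gt0.
Qed.

Lemma is_cfc_unit f a b (x y : R) : is_cfc f a b -> spectrum_in a x y ->
  (forall t, x <= t <= y -> {for t, continuous f}) ->
  (forall t, x <= t <= y -> f t != 0) ->
  b \is a GRing.unit /\ is_cfc (fun t => (f t)^-1) a b^-1.
Proof.
move=> fab axy fc f0; have sa := is_cfc_sa fab.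
have [|c fVc] := @is_cfc_exists (fun t => (f t)^-1) a x y sa axy.
  by move=> t xty; apply: cvgV; [exact: f0|exact: fc].
have bc : b * c = 1.
  apply: (is_cfc_unique _ (is_cfc1 sa)).
  apply: eq_is_cfc (is_cfcM fab fVc) => t st.
  by rewrite divff// f0 ?axy.
have cb : c * b = 1.
  apply: (is_cfc_unique _ (is_cfc1 sa)).
  apply: eq_is_cfc (is_cfcM fVc fab) => t st.
  by rewrite mulVf// f0 ?axy.
have ub : b \is a GRing.unit by apply/unitrP; exists c.
split=> //; suff <- : c = b^-1 by [].
by apply: (mulrI ub); rewrite bc divrr.
Qed.

(** If f misses s on the whole interval, f - s has a continuous reciprocal there, so b - s is
    invertible. *)
Lemma is_cfc_spectrum_image f a b (x y s : R) : is_cfc f a b -> spectrum_in a x y ->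
  (forall t, x <= t <= y -> {for t, continuous f}) ->
  spectrum b s%:C -> exists2 t, x <= t <= y & f t = s.
Proof.
move=> fab axy fc sb; apply: contrapT => none; apply: (negP sb).
have fs := is_cfcD fab (is_cfc_cst (- s) (is_cfc_sa fab)).
rewrite -scaleNr -rmorphN; case: (@is_cfc_unit _ _ _ x y fs axy) => // t xty.
  by apply: cvgD; [exact: fc|exact: cvg_cst].
by apply/eqP => /eqP; rewrite subr_eq0 => /eqP fts; apply: none; exists t.
Qed.

End ContinuousCalculus.

(** * Positive elements and the positivity of [star a * a] *)

Section Positivity.
Variables (R : realType) (A : cstarAlgType R).
Implicit Types (a b c h k : A).

Definition positive h := star h = h /\ forall t : R, spectrum h t%:C -> 0 <= t.

(** Positivity becomes a norm inequality, which the triangle inequality makes stable under sums even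
    when the summands do not commute. *)
Lemma positiveP h (M : R) : star h = h -> cnorm h <= M ->
  positive h <-> cnorm (M%:C%:A - h) <= M.
Proof.
move=> sh hM; have Mh : peval h (M%:P - 'X) = M%:C%:A - h.
  by rewrite pevalB pevalC pevalX.
split=> [[_ h0]|nM].
  rewrite -Mh; apply: peval_norm_le => // t st; rewrite !hornerE.
  have := h0 t st; have /andP[_ th] := spectrum_itv st => t0.
  by rewrite ger0_norm; lra.
split=> // t /(spectrum_peval (M%:P - 'X)); rewrite Mh !hornerE => /spectrum_itv.
by move=> /andP[_]; lra.
Qed.

Lemma positiveD h k : positive h -> positive k -> positive (h + k).
Proof.
move=> ph pk; have [sh _] := ph; have [sk _] := pk.
apply: (positiveP _ (cnormD h k)).2; first by rewrite starD sh sk.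
have := (positiveP sh (lexx _)).1 ph; have := (positiveP sk (lexx _)).1 pk.
have -> : (cnorm h + cnorm k)%:C%:A - (h + k) =
    ((cnorm h)%:C%:A - h) + ((cnorm k)%:C%:A - k).
  by rewrite rmorphD scalerDl opprD addrACA.
have := cnormD ((cnorm h)%:C%:A - h) ((cnorm k)%:C%:A - k); lra.
Qed.

Lemma positive_sqr h : star h = h -> positive (h ^+ 2).
Proof.
move=> sh; split=> [|t]; first exact: star_sqr_sa.
by rewrite -pevalXn => /(peval_spectrum sh)[s _ <-]; rewrite hornerXn sqr_ge0.
Qed.

Lemma is_cfc_positive f h b (x y : R) : is_cfc f h b -> spectrum_in h x y ->
  (forall t, x <= t <= y -> {for t, continuous f}) ->
  (forall t, x <= t <= y -> 0 <= f t) -> positive b.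
Proof.
move=> fhb hxy fc f0; split=> [|t]; first exact: is_cfc_star fhb.
by move=> /(is_cfc_spectrum_image fhb hxy fc)[s /f0 ? <-].
Qed.

Lemma spectrumN a (l : R[i]) : spectrum (- a) l <-> spectrum a (- l).
Proof. by rewrite /spectrum /= scaleNr opprK -opprD unitrN. Qed.

Lemma positive_eq0 h : positive h -> positive (- h) -> h = 0.
Proof.
move=> [sh h0] [_ h0']; apply: cnorm_spectrum0 => // t st; apply/le_anti.
rewrite h0// andbT -oppr_ge0 h0'//; by apply/spectrumN; rewrite rmorphN opprK.
Qed.

(** With c the inverse of ba - l, the inverse of ab - l is (a c b - 1) / l. *)
Lemma spectrum_mulC a b (l : R[i]) :
  l != 0 -> spectrum (a * b) l -> spectrum (b * a) l.
Proof.
move=> l0 sab; apply/negP => uba; apply: (negP sab).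
pose c := (b * a - l%:A)^-1.
have baE : b * a = b * a - l%:A + l%:A by rewrite subrK.
have E1 : (a * b - l%:A) * (a * c * b - 1) = l%:A.
  have -> : (a * b - l%:A) * (a * c * b - 1) =
      a * ((b * a - l%:A) * c) * b - a * b + l%:A.
    rewrite mulrBr mulr1 opprB addrA addrAC; congr (_ - _ + _); last first.
    rewrite !mulrBl !mulrBr !mulrBl !mulrA; congr (_ - _).
    by rewrite -!scalerAl -!scalerAr mul1r mulr1 -!scalerAl.
  by rewrite divrr// mulr1 subrr add0r.
have E2 : (a * c * b - 1) * (a * b - l%:A) = l%:A.
  have -> : (a * c * b - 1) * (a * b - l%:A) =
      a * (c * (b * a - l%:A)) * b - a * b + l%:A.
    rewrite mulrBl mul1r opprB addrA addrAC; congr (_ - _ + _); last first.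
    rewrite !mulrBr !mulrBl !mulrA; congr (_ - _).
    by rewrite -!scalerAr !mulr1 -scalerAl.
  by rewrite mulVr// mulr1 subrr add0r.
apply/unitrP; exists (l^-1 *: (a * c * b - 1)).
by rewrite -scalerAl -scalerAr E1 E2 scalerA mulVf// scale1r.
Qed.

(** Only nonzero spectral points can violate the sign, and these are common to the products in the
    two orders. *)
Lemma positive_swap b : positive (- (star b * b)) -> positive (- (b * star b)).
Proof.
move=> [_ b0]; split=> [|t]; first by rewrite starN starM starK.
move=> /spectrumN sb; rewrite leNgt; apply/negP => t0.
suff : 0 <= t by rewrite leNgt t0.
by apply/b0/spectrumN/spectrum_mulC => //; rewrite -rmorphN fmorph_eq0 oppr_eq0 lt_eqF.
Qed.

(* By polarization b^*b + bb^* is a sum of two squares; if -b^*b >= 0 then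
   -bb^* >= 0 as well, whence b^*b >= 0. *)
Lemma star_mul_le0 b : positive (- (star b * b)) -> star b * b = 0.
Proof.
move=> nb; have nb' := positive_swap nb.
pose p := b + star b; pose r := 'i *: (b - star b).
have sp : star p = p by rewrite starD starK addrC.
have sr : star r = r.
  rewrite starZ starB starK -opprB scalerN -scaleNr; congr (_ *: _).
  by apply/eqP; rewrite eq_complex /= oppr0 opprK !eqxx.
have E : star b * b + star b * b =
    p ^+ 2 + r ^+ 2 + (- (b * star b) + - (b * star b)).
  have -> : r ^+ 2 = - (b - star b) ^+ 2.
    rewrite exprZn (_ : 'i ^+ 2 = -1) ?scaleN1r//.
    by apply/eqP; rewrite eq_complex /=; apply/andP; split; apply/eqP; ring.
  set q := b - star b; rewrite -opprD; apply/esym/subr0_eq.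
  suff -> : p ^+ 2 - q ^+ 2 = star b * b + star b * b + (b * star b + b * star b).
    by rewrite addrK subrr.
  rewrite !expr2 {2}/p {2}/q mulrDr mulrBr opprB [_ - _ * b]addrC addrACA -mulrBl -mulrDl.
  have -> : p - q = star b + star b by rewrite /p /q opprB addrC addrA subrK.
  have -> : p + q = b + b by rewrite /p /q addrACA subrr addr0.
  by rewrite !mulrDl.
have ps : positive (star b * b + star b * b).
  rewrite E; apply: positiveD; apply: positiveD => //; exact: positive_sqr.
have /positive_eq0 : positive (- (star b * b + star b * b)).
  by rewrite opprD; apply: positiveD.
rewrite opprK => /(_ ps)/eqP; rewrite oppr_eq0 => /eqP b0.
by rewrite -[LHS]scale_half b0 scaler0.
Qed.

(* If h_- is the negative part of h := a^*a, then b := a h_- has b^*b = - h_-^3. *)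
Lemma positive_star_mul a : positive (star a * a).
Proof.
set h := star a * a; have sh : star h = h by rewrite starM starK.
split=> // t st; rewrite leNgt; apply/negP => t0.
pose f (t : R) := Num.max (- t) 0.
have hh : spectrum_in h (- cnorm h) (cnorm h) by move=> s; exact: spectrum_itv.
have fc : continuous f.
  by move=> s; apply: continuous_max; [exact: opp_continuous|exact: cst_continuous].
have [m fm] := is_cfc_exists sh hh (fun t _ => fc t).
have bE : is_cfc (fun t => -1 * (f t * t * f t)) h (- (star (a * m) * (a * m))).
  have := is_cfcZ (-1) (is_cfcM (is_cfcM fm (is_cfc_id sh)) fm).
  by rewrite rmorphN1 scaleN1r starM (is_cfc_star fm) /h !mulrA.
have b0 : star (a * m) * (a * m) = 0.
  apply: star_mul_le0; apply: (is_cfc_positive bE hh) => s _.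
    apply: cvgM; first exact: cvg_cst.
    by apply: cvgM; [apply: cvgM; [exact: fc|exact: cvg_id]|exact: fc].
  rewrite /f; case: (leP (- s) 0) => s0; first by rewrite mul0r mulr0.
  nra.
(* As the element vanishes, so does its function on the spectrum; but at t < 0 its value is
   (-t)^3. *)
have := is_cfc_le bE st; rewrite b0 oppr0 cnorm0 normr_le0 /f.
have -> : Num.max (- t) 0 = - t by apply/max_idPl; lra.
have : 0 < (- t) ^+ 3 by rewrite exprn_gt0// oppr_gt0.
move=> ? /eqP; nra.
Qed.

End Positivity.

(** * Hyperbolic functions of a square root, as power series *)

Section HyperbolicFunctions.
Variable R : realType.
Implicit Types (r s t x y K : R) (u : nat -> R).

(** The error is bounded by a tail of the exponential series at [K], the same for all [u] dominated
    by it; hence convergence is uniform on bounded sets. *)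
Lemma series_exp_dominated u K : (forall k, `|u k| <= exp_coeff K k) ->
  cvgn (series u) /\
  forall n, `|series u n - limn (series u)| <= expR K - series (exp_coeff K) n.
Proof.
move=> uK; have cu : cvgn (series u).
  apply: normed_cvg; apply: series_le_cvg (is_cvg_series_exp_coeff K) => n //=.
  exact: le_trans (uK n).
split=> // n; rewrite distrC.
have cN : (fun m => `|series u m - series u n|) @ \oo --> `|limn (series u) - series u n|.
  by apply: cvg_norm; apply: cvgB => //; exact: cvg_cst.
have cE : (fun m => series (exp_coeff K) m - series (exp_coeff K) n) @ \oo -->
    expR K - series (exp_coeff K) n.
  by apply: cvgB (cvg_cst _); exact: is_cvg_series_exp_coeff.
apply: (ler_cvg_to cN cE); exists n => // m /= nm.
rewrite !sub_series nm; apply: le_trans (ler_norm_sum _ _ _) _.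
by apply: ler_sum => k _.
Qed.

(** The vanishing terms are kept in place, so that partial sums match those of the scalar and matrix
    exponentials term by term. *)
Definition even_coeff s k := if odd k then 0 else k`!%:R^-1 * s ^+ k./2.
Definition odd_coeff s k := if odd k then k`!%:R^-1 * s ^+ k./2 else 0.

(* che s = cosh (sqrt s) and she s = sinh (sqrt s) / sqrt s, as entire functions
   of s. *)
Definition che s := limn (series (even_coeff s)).
Definition she s := limn (series (odd_coeff s)).

Lemma even_coeff_le s K k : 0 <= K -> `|s| <= K ^+ 2 ->
  `|even_coeff s k| <= exp_coeff K k.
Proof.
move=> K0 sK; rewrite exp_coeffE /even_coeff; case: ifPn => ok.
  by rewrite normr0 mulr_ge0 ?invr_ge0 ?exprn_ge0.
rewrite normrM ger0_norm ?invr_ge0// ler_wpM2l ?invr_ge0//.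
rewrite -{2}(even_halfK ok) -mul2n exprM normrX lerXn2r// nnegrE//.
by rewrite exprn_ge0.
Qed.

(** For odd k the bound on the power of s is K^(k-1), which is at most K^k because K >= 1. *)
Lemma odd_coeff_le s K k : 1 <= K -> `|s| <= K ^+ 2 ->
  `|odd_coeff s k| <= exp_coeff K k.
Proof.
move=> K1 sK; have K0 : 0 <= K by lra.
rewrite exp_coeffE /odd_coeff; case: ifPn => ok; last first.
  by rewrite normr0 mulr_ge0 ?invr_ge0 ?exprn_ge0.
rewrite normrM ger0_norm ?invr_ge0// ler_wpM2l ?invr_ge0//.
apply: (@le_trans _ _ ((K ^+ 2) ^+ k./2)).
  by rewrite normrX lerXn2r// nnegrE// exprn_ge0.
rewrite -exprM mul2n ler_weXn2l//.
by rewrite -{2}(odd_double_half k) ok add1n leqnSn.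
Qed.

(** The [+ 1] gives both the bound K >= 1 needed for the odd series and a strict inequality |s| <
    K^2, so that the estimates hold near s. *)
Definition sqrt_bound s := Num.sqrt `|s| + 1.

Lemma sqrt_boundP s : 1 <= sqrt_bound s /\ `|s| <= sqrt_bound s ^+ 2.
Proof.
have := sqrtr_ge0 `|s|; have := sqr_sqrtr (normr_ge0 s).
by rewrite /sqrt_bound sqrrD; lra.
Qed.

Lemma cvg_even s : series (even_coeff s) @ \oo --> che s.
Proof.
have [K1 sK] := sqrt_boundP s.
by apply: (@series_exp_dominated _ (sqrt_bound s) _).1 => k; apply: even_coeff_le => //; lra.
Qed.

Lemma cvg_odd s : series (odd_coeff s) @ \oo --> she s.
Proof.
have [K1 sK] := sqrt_boundP s.
by apply: (@series_exp_dominated _ (sqrt_bound s) _).1 => k; apply: odd_coeff_le.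
Qed.

(** The even and odd parts of exp; evaluation at x and -x expresses tanh through them. *)
Lemma exp_split x : expR x = che (x ^+ 2) + x * she (x ^+ 2).
Proof.
have c1 : series (exp_coeff x) @ \oo --> expR x by exact: is_cvg_series_exp_coeff.
have c2 : (fun n => series (even_coeff (x ^+ 2)) n + x * series (odd_coeff (x ^+ 2)) n)
    @ \oo --> che (x ^+ 2) + x * she (x ^+ 2).
  by apply: cvgD; [exact: cvg_even|apply: cvgMr; exact: cvg_odd].
suff E : series (exp_coeff x) = (fun n =>
    series (even_coeff (x ^+ 2)) n + x * series (odd_coeff (x ^+ 2)) n).
  by rewrite E in c1; apply: (cvg_unique _ c1 c2).
apply/funext => n; rewrite /series /= mulr_sumr -big_split /=; apply: eq_bigr => k _.
rewrite exp_coeffE /even_coeff /odd_coeff; case: ifPn => ok.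
  rewrite add0r mulrCA -exprM mul2n -exprS.
  by rewrite -{2}(odd_double_half k) ok.
by rewrite mulr0 addr0 -exprM mul2n even_halfK.
Qed.

Lemma che_ge1 s : 0 <= s -> 1 <= che s.
Proof.
move=> s0; apply: limr_ge; first by apply/cvg_ex; exists (che s); exact: cvg_even.
exists 1%N => // -[//|n] _; rewrite /series /= big_nat_recl//.
rewrite {1}/even_coeff /= fact0 invr1 mul1r expr0 lerDl; apply: sumr_ge0 => k _.
by rewrite /even_coeff; case: ifP => // _; rewrite mulr_ge0 ?invr_ge0 ?exprn_ge0.
Qed.

Lemma she_ge1 s : 0 <= s -> 1 <= she s.
Proof.
move=> s0; apply: limr_ge; first by apply/cvg_ex; exists (she s); exact: cvg_odd.
exists 2%N => // -[//|[//|n]] _; rewrite /series /= !big_nat_recl//.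
rewrite {1 2}/odd_coeff /= add0r invr1 mul1r expr0 lerDl; apply: sumr_ge0 => k _.
by rewrite /odd_coeff; case: ifP => // _; rewrite mulr_ge0 ?invr_ge0 ?exprn_ge0.
Qed.

Definition even_poly n : {poly R} :=
  \sum_(k < n) if odd k then 0 else k`!%:R^-1 *: 'X^(k./2).
Definition odd_poly n : {poly R} :=
  \sum_(k < n) if odd k then k`!%:R^-1 *: 'X^(k./2) else 0.

Lemma even_polyE n s : (even_poly n).[s] = series (even_coeff s) n.
Proof.
rewrite /series /= big_mkord horner_sum; apply: eq_bigr => k _.
by rewrite /even_coeff; case: ifP => _; rewrite !hornerE ?hornerXn.
Qed.

Lemma odd_polyE n s : (odd_poly n).[s] = series (odd_coeff s) n.
Proof.
rewrite /series /= big_mkord horner_sum; apply: eq_bigr => k _.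
by rewrite /odd_coeff; case: ifP => _; rewrite !hornerE ?hornerXn.
Qed.

Lemma exp_tail K e : 0 < e -> exists N, forall n, (N <= n)%N ->
  expR K - series (exp_coeff K) n < e.
Proof.
move=> e0; have c1 : series (exp_coeff K) @ \oo --> expR K by exact: is_cvg_series_exp_coeff.
have /cvgrPdist_lt/(_ e e0)[N _ Nh] := c1; exists N => n Nn.
by have := Nh n Nn; rewrite /= => /ltr_normlW.
Qed.

Lemma even_poly_cvg K : 0 <= K -> {uniform [set s : R | `|s| <= K ^+ 2],
  (fun n s => (even_poly n).[s]) @ \oo --> che}.
Proof.
move=> K0; apply/uniform_cvgP => e /(exp_tail K)[N Nh]; exists N => n Nn s /= sK.
rewrite even_polyE; apply: le_lt_trans (Nh n Nn).
by apply: (@series_exp_dominated _ K _).2 => k; apply: even_coeff_le.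
Qed.

Lemma odd_poly_cvg K : 1 <= K -> {uniform [set s : R | `|s| <= K ^+ 2],
  (fun n s => (odd_poly n).[s]) @ \oo --> she}.
Proof.
move=> K1; apply/uniform_cvgP => e /(exp_tail K)[N Nh]; exists N => n Nn s /= sK.
rewrite odd_polyE; apply: le_lt_trans (Nh n Nn).
by apply: (@series_exp_dominated _ K _).2 => k; apply: odd_coeff_le.
Qed.

Lemma uniform_poly_continuous (S : set R) (q : nat -> {poly R}) (f : R -> R) s :
  nbhs s S -> {uniform S, (fun n s => (q n).[s]) @ \oo --> f} ->
  {for s, continuous f}.
Proof.
move=> Ss /uniform_cvgP qf; apply/cvgrPdist_lt => e e0.
have [|N Nq] := qf (e / 3); first by rewrite divr_gt0.
have qc : {for s, continuous (fun t => (q N).[t])} by exact: continuous_horner.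
have /cvgrPdist_lt/(_ (e / 3)) := qc.
rewrite divr_gt0// => /(_ isT) qs.
near=> t.
have St : S t by near: t.
have := Nq N (leqnn N) t St; have := Nq N (leqnn N) s (nbhs_singleton Ss).
have : `|(q N).[s] - (q N).[t]| < e / 3 by near: t.
have -> : f s - f t =
    (((q N).[s] - (q N).[t]) - ((q N).[s] - f s)) + ((q N).[t] - f t) by ring.
move=> h1 h2 h3; apply: le_lt_trans (ler_normD _ _) _.
by have := ler_normB ((q N).[s] - (q N).[t]) ((q N).[s] - f s); lra.
Unshelve. all: by end_near. Qed.

Lemma nbhs_sqrt_bound s : nbhs s [set t : R | `|t| <= sqrt_bound s ^+ 2].
Proof.
have sb : `|s| < sqrt_bound s ^+ 2.
  have := sqrtr_ge0 `|s|; have := sqr_sqrtr (normr_ge0 s).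
  by rewrite /sqrt_bound sqrrD; lra.
apply/nbhs_ballP; exists (sqrt_bound s ^+ 2 - `|s|); first by rewrite /= subr_gt0.
move=> t; rewrite /ball /= => st; have := ler_normB s (s - t); rewrite subKr; lra.
Qed.

Lemma che_continuous : continuous che.
Proof.
move=> s; have [K1 _] := sqrt_boundP s.
by apply: uniform_poly_continuous (nbhs_sqrt_bound s) _; apply: even_poly_cvg; lra.
Qed.

Lemma she_continuous : continuous she.
Proof.
move=> s; have [K1 _] := sqrt_boundP s.
by apply: uniform_poly_continuous (nbhs_sqrt_bound s) _; exact: odd_poly_cvg.
Qed.

(** The function tanh(sqrt s) / sqrt s, with value 1 at s = 0, where no division by sqrt s takes
    place. *)
Definition tanhc s := she s / che s.

Lemma tanhc_gt0 s : 0 <= s -> 0 < tanhc s.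
Proof.
move=> s0; have c1 := che_ge1 s0; have s1 := she_ge1 s0.
by rewrite divr_gt0//; lra.
Qed.

Lemma tanhc_continuous s : 0 <= s -> {for s, continuous tanhc}.
Proof.
move=> s0; have c1 := che_ge1 s0.
by apply: cvgM; [exact: she_continuous|apply: cvgV; [lra|exact: che_continuous]].
Qed.

Lemma tanhcE s : 0 <= s -> Num.sqrt s * tanhc s = tanh (Num.sqrt s).
Proof.
move=> s0; have c1 := che_ge1 s0; rewrite /tanh (exp_split (Num.sqrt s)).
rewrite (exp_split (- _)) sqrrN sqr_sqrtr// /tanhc; field; lra.
Qed.

Lemma tanh_continuous : continuous (@tanh R).
Proof.
move=> s; rewrite /tanh; have eN : {for s, continuous (fun t : R => expR (- t))}.
  by apply: continuous_comp; [exact: opp_continuous|exact: continuous_expR].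
have es := @continuous_expR R s.
apply: cvgM; first exact: cvgB.
by apply: cvgV; [rewrite gt_eqF// addr_gt0 ?expR_gt0|exact: cvgD].
Qed.

Lemma tanh_ge0 x : 0 <= x -> 0 <= tanh x.
Proof.
move=> x0; apply: divr_ge0; first by rewrite subr_ge0 ler_expR; lra.
by rewrite addr_ge0 ?expR_ge0.
Qed.

Lemma tanh_lt1 x : tanh x < 1.
Proof.
have := expR_gt0 x; have := expR_gt0 (- x).
by move=> h1 h2; rewrite /tanh ltr_pdivrMr; lra.
Qed.

Definition atanh x := 2^-1 * ln ((1 + x) / (1 - x)).

Lemma tanhK x : atanh (tanh x) = x.
Proof.
have h1 := expR_gt0 x; have h2 := expR_gt0 (- x).
rewrite /atanh (_ : _ / _ = expR (2 * x)) ?expRK ?mulKf//.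
rewrite mulr_natl mulr2n expRD /tanh.
have : expR x * expR (- x) = 1 by rewrite -expRD subrr expR0.
move: (expR x) (expR (- x)) h1 h2 => u v u0 v0 uv.
have -> : (1 + (u - v) / (u + v)) / (1 - (u - v) / (u + v)) = u / v.
  by field; rewrite ?gt_eqF//; lra.
have v1 : v != 0 by rewrite gt_eqF.
by apply: (mulIf v1); rewrite divfK// -mulrA uv mulr1.
Qed.

Lemma atanhK x : 0 <= x < 1 -> tanh (atanh x) = x.
Proof.
move=> /andP[x0 x1]; have y0 : 0 < (1 + x) / (1 - x) by rewrite divr_gt0//; lra.
have E : expR (atanh x) * expR (atanh x) = (1 + x) / (1 - x).
  rewrite -expRD /atanh -mulrDl (_ : 2^-1 + 2^-1 = 1) ?mul1r ?lnK ?posrE//.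
  by field.
rewrite /tanh expRN; have := expR_gt0 (atanh x).
move: (expR (atanh x)) E => u E u0.
have -> : (u - u^-1) / (u + u^-1) = (u * u - 1) / (u * u + 1).
  by field; rewrite ?gt_eqF//; nra.
by rewrite E; field; lra.
Qed.

Lemma ratio_ge1 x : 0 <= x < 1 -> 1 <= (1 + x) / (1 - x).
Proof. by move=> /andP[x0 x1]; rewrite ler_pdivlMr; lra. Qed.

Lemma atanh_ge0 x : 0 <= x < 1 -> 0 <= atanh x.
Proof. by move=> x1; rewrite mulr_ge0 ?invr_ge0// ln_ge0// ratio_ge1. Qed.

Lemma ratio_continuous x : x < 1 -> {for x, continuous (fun t : R => (1 + t) / (1 - t))}.
Proof.
move=> x1; apply: cvgM; first by apply: cvgD; [exact: cvg_cst|exact: cvg_id].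
by apply: cvgV; [lra|apply: cvgB; [exact: cvg_cst|exact: cvg_id]].
Qed.

Lemma atanh_continuous x : 0 <= x < 1 -> {for x, continuous atanh}.
Proof.
move=> x01; have r1 := ratio_ge1 x01; have /andP[x0 x1] := x01.
apply: cvgMr; apply: (@continuous_comp _ _ _ (fun t : R => (1 + t) / (1 - t)) (@ln R)).
  exact: ratio_continuous.
by apply: continuous_ln; lra.
Qed.

(** The square of tanh(sqrt s), in the shape f(s) s f(s) that the calculus yields for
    [star (a * b) * (a * b)] when b = f([star a * a]). *)
Definition tanh_sqr s := tanhc s * s * tanhc s.
Definition atanh_sqr r := atanh (Num.sqrt r) ^+ 2.
(* atanhc r = artanh (sqrt r) / sqrt r, written so that it is continuous at 0. *)
Definition atanhc r := (tanhc (atanh_sqr r))^-1.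

Lemma sqrt_lt1 r : 0 <= r < 1 -> 0 <= Num.sqrt r < 1.
Proof.
move=> /andP[r0 r1]; rewrite sqrtr_ge0 /=; have := sqr_sqrtr r0.
by have := sqrtr_ge0 r; nra.
Qed.

Lemma sqrt_tanh_sqr s : 0 <= s -> Num.sqrt (tanh_sqr s) = tanh (Num.sqrt s).
Proof.
move=> s0; have -> : tanh_sqr s = (tanh (Num.sqrt s)) ^+ 2.
  rewrite -tanhcE// exprMn sqr_sqrtr// /tanh_sqr; ring.
by rewrite sqrtr_sqr ger0_norm// tanh_ge0// sqrtr_ge0.
Qed.

Lemma tanh_sqr_itv s : 0 <= s -> 0 <= tanh_sqr s < 1.
Proof.
move=> s0; have t0 := tanh_ge0 (sqrtr_ge0 s); have t1 := tanh_lt1 (Num.sqrt s).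
have h0 : 0 <= tanh_sqr s.
  have tp := ltW (tanhc_gt0 s0); by apply: mulr_ge0 => //; exact: mulr_ge0.
rewrite h0 /=; have := sqr_sqrtr h0; rewrite sqrt_tanh_sqr// => <-.
by rewrite expr2; nra.
Qed.

Lemma tanh_sqr_continuous s : 0 <= s -> {for s, continuous tanh_sqr}.
Proof.
move=> s0; have tc := tanhc_continuous s0.
by apply: cvgM => //; apply: cvgM => //; exact: cvg_id.
Qed.

Lemma atanh_tanh_sqr s : 0 <= s -> atanh_sqr (tanh_sqr s) = s.
Proof. by move=> s0; rewrite /atanh_sqr sqrt_tanh_sqr// tanhK sqr_sqrtr. Qed.

Lemma atanh_sqr_ge0 r : 0 <= atanh_sqr r.
Proof. exact: sqr_ge0. Qed.

Lemma sqrt_atanh_sqr r : 0 <= r < 1 -> Num.sqrt (atanh_sqr r) = atanh (Num.sqrt r).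
Proof.
move=> /sqrt_lt1 r1; rewrite sqrtr_sqr ger0_norm//; exact: atanh_ge0.
Qed.

(** For y = artanh(sqrt r), the identity sqrt r = tanh y = y [tanhc](y^2) is solved for y. *)
Lemma sqrt_atanhc r : 0 <= r < 1 -> Num.sqrt r * atanhc r = atanh (Num.sqrt r).
Proof.
move=> r1; have s1 := sqrt_lt1 r1; have t0 := tanhc_gt0 (atanh_sqr_ge0 r).
rewrite -{1}(atanhK s1) -(sqrt_atanh_sqr r1) -tanhcE ?atanh_sqr_ge0//.
by rewrite /atanhc mulfK ?gt_eqF.
Qed.

Lemma atanhc_sqr r : 0 <= r < 1 -> atanhc r * r * atanhc r = atanh_sqr r.
Proof.
move=> r1; have /andP[r0 _] := r1; rewrite /atanh_sqr -(sqrt_atanhc r1) exprMn.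
by rewrite sqr_sqrtr//; ring.
Qed.

Lemma atanh_sqr_continuous r : 0 <= r < 1 -> {for r, continuous atanh_sqr}.
Proof.
move=> r1; have s1 := sqrt_lt1 r1.
apply: (@continuous_comp _ _ _ (fun r => atanh (Num.sqrt r)) (fun x : R => x ^+ 2)).
  apply: (@continuous_comp _ _ _ Num.sqrt atanh); first exact: sqrt_continuous.
  exact: atanh_continuous.
exact: exprn_continuous.
Qed.

Lemma tanhc_atanh_sqr_continuous r : 0 <= r < 1 ->
  {for r, continuous (tanhc \o atanh_sqr)}.
Proof.
move=> r1; apply: continuous_comp; first exact: atanh_sqr_continuous.
exact/tanhc_continuous/atanh_sqr_ge0.
Qed.

End HyperbolicFunctions.

(** * The exponential map at 0 and its inverse *)

Section Exponential.
Variables (R : realType) (A : cstarAlgType R).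
Implicit Types (a b z alpha h : A).

Lemma norm_lim_eq (u : nat -> A) l : norm_cvg u l -> norm_lim u = l.
Proof.
move=> ul; apply: (norm_cvg_unique _ ul).
by apply: (@xgetPex _ 0 [set l | norm_cvg u l]); exists l.
Qed.

Lemma spectrum_star_mul a : spectrum_in (star a * a) 0 (cnorm a ^+ 2).
Proof.
move=> t st; rewrite (positive_star_mul a).2//= -cnorm_star.
by have /andP[] := spectrum_itv st.
Qed.

Lemma star_star_mul a : star (star a * a) = star a * a.
Proof. by rewrite starM starK. Qed.

(** The Moebius action at w = 0 sees only the first column of the matrix. *)
Lemma mx2_exp a k :
  (mx2 0 (star a) a 0 ^+ k) 0 0 = (if odd k then 0 else (star a * a) ^+ k./2) /\
  (mx2 0 (star a) a 0 ^+ k) 1 0 = (if odd k then a * (star a * a) ^+ k./2 else 0).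
Proof.
elim: k => [|k [IH0 IH1]]; first by rewrite expr0 !mxE.
rewrite exprS !mxE !big_ord_recl !big_ord0 !mxE /= !addr0 !mul0r addr0 add0r.
rewrite (_ : lift ord0 ord0 = 1) ?IH0 ?IH1; last exact/val_inj.
rewrite uphalf_half; case: (odd k) => /=; rewrite ?mulr0//.
by rewrite add1n exprS mulrA.
Qed.

Lemma peval_even a n : peval (star a * a) (even_poly R n) =
  \sum_(k < n) (k`!%:R^-1 : R[i]) *: (mx2 0 (star a) a 0 ^+ k) 0 0.
Proof.
rewrite /peval /even_poly !rmorph_sum; apply: eq_bigr => k _.
rewrite (mx2_exp a k).1; case: ifP => _.
  by rewrite !rmorph0 scaler0.
by rewrite -[LHS]/(peval _ _) pevalZ pevalXn fmorphV rmorph_nat.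
Qed.

Lemma peval_odd a n : a * peval (star a * a) (odd_poly R n) =
  \sum_(k < n) (k`!%:R^-1 : R[i]) *: (mx2 0 (star a) a 0 ^+ k) 1 0.
Proof.
rewrite /peval /odd_poly !rmorph_sum mulr_sumr; apply: eq_bigr => k _.
rewrite (mx2_exp a k).2; case: ifP => _; last first.
  by rewrite !rmorph0 mulr0 scaler0.
by rewrite -[X in _ * X]/(peval _ _) pevalZ pevalXn fmorphV rmorph_nat scalerAr.
Qed.

Lemma bound_spectrum a : [set t : R | spectrum (star a * a) t%:C] `<=`
  [set t : R | `|t| <= sqrt_bound (cnorm a ^+ 2) ^+ 2].
Proof.
move=> t /= /spectrum_star_mul /andP[t0 ta]; rewrite ger0_norm//.
have [_] := sqrt_boundP (cnorm a ^+ 2); rewrite ger0_norm ?sqr_ge0//.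
exact: le_trans.
Qed.

Lemma Exp0_tanhc alpha : exists2 G, is_cfc (@tanhc R) (star alpha * alpha) G &
  Exp0 alpha = alpha * G.
Proof.
set h := star alpha * alpha; have sh := star_star_mul alpha.
have [K1 _] := sqrt_boundP (cnorm alpha ^+ 2).
have hs := @spectrum_star_mul alpha.
have [|C hC cC] := @is_cfc_lim _ _ (@che R) h (even_poly R) sh.
  apply: (uniform_subset_cvg _ (@bound_spectrum alpha)).
  by apply: even_poly_cvg; lra.
have [|S hS cS] := @is_cfc_lim _ _ (@she R) h (odd_poly R) sh.
  apply: (uniform_subset_cvg _ (@bound_spectrum alpha)).
  exact: odd_poly_cvg.
have [||uC hCV] := is_cfc_unit hC hs.
- by move=> t _; exact: che_continuous.
- by move=> t /andP[t0 _]; rewrite gt_eqF// (lt_le_trans ltr01)// che_ge1.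
exists (S * C^-1); first exact: is_cfcM hS hCV.
rewrite /Exp0 /geodesic0 /moebius.
have -> : map_mx ( *:%R 1%:C) (mx2 0 (star alpha) alpha 0) = mx2 0 (star alpha) alpha 0.
  by apply/matrixP => i j; rewrite mxE rmorph1 scale1r.
rewrite !mulr0 !addr0 !mxE.
rewrite (_ : norm_lim _ = alpha * S).
  rewrite (_ : norm_lim _ = C) ?mulrA//; apply: norm_lim_eq.
  by rewrite (_ : (fun n => _) = (fun n => peval h (even_poly R n)))//;
    apply/funext => n; rewrite peval_even.
apply: norm_lim_eq.
rewrite (_ : (fun n => _) = (fun n => alpha * peval h (odd_poly R n))).
  exact: norm_cvgM (norm_cvg_cst _) cS.
by apply/funext => n; rewrite peval_odd.
Qed.

Lemma is_cfc_star_mul a f b : is_cfc f (star a * a) b ->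
  is_cfc (fun t => f t * t * f t) (star a * a) (star (a * b) * (a * b)).
Proof.
move=> fb; have := is_cfcM (is_cfcM fb (is_cfc_id (is_cfc_sa fb))) fb.
by rewrite starM (is_cfc_star fb) !mulrA.
Qed.

Lemma is_cfc_cabs a : is_cfc Num.sqrt (star a * a) (cabs a).
Proof.
have [|b ab] := @is_cfc_exists _ _ Num.sqrt _ _ _ (star_star_mul a) (@spectrum_star_mul a).
  by move=> t _; exact: sqrt_continuous.
by rewrite /cabs (cfc_eq ab).
Qed.

Lemma star_mul_Exp0 alpha :
  is_cfc (@tanh_sqr R) (star alpha * alpha) (star (Exp0 alpha) * Exp0 alpha).
Proof. by have [G hG ->] := Exp0_tanhc alpha; exact: is_cfc_star_mul. Qed.

(** The norm of [star z * z] is attained up to sign in its spectrum, hence is a value of [tanh_sqr]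
    up to sign; this keeps the inequality strict. *)
Lemma unit_ball_Exp0 alpha : unit_ball (Exp0 alpha).
Proof.
rewrite /unit_ball /=; set z := Exp0 alpha; have hz := star_mul_Exp0 alpha.
rewrite -/z in hz; have hs := @spectrum_star_mul alpha.
have tc t : 0 <= t <= cnorm alpha ^+ 2 -> {for t, continuous (@tanh_sqr R)}.
  by move=> /andP[t0 _]; exact: tanh_sqr_continuous.
suff : cnorm (star z * z) < 1.
  by rewrite cnorm_star -[X in _ < X](expr1n _ 2) ltr_sqr// nnegrE ?cnorm_ge0.
have := cnorm_spectrum_sa (star_star_mul z).
move=> -[] /(is_cfc_spectrum_image hz hs tc)[t /andP[/tanh_sqr_itv/andP[t0 t1] _] tE].
  by rewrite -tE.
lra.
Qed.

(** Both sides are functions of [star alpha * alpha], the left one by composition through [|alpha|];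
    uniqueness of the calculus identifies them. *)
Lemma cabs_mul_Exp0 alpha G : is_cfc (@tanhc R) (star alpha * alpha) G ->
  cfc (@tanh R) (cabs alpha) = cabs alpha * G.
Proof.
move=> hG; have ha := is_cfc_cabs alpha; have sa := is_cfc_star ha.
have [|T aT] := @is_cfc_exists _ _ (@tanh R) (cabs alpha) _ _ sa (@spectrum_itv _ _ _).
  by move=> t _; exact: tanh_continuous.
rewrite (cfc_eq aT); apply: (is_cfc_unique (is_cfc_comp ha aT)).
apply: eq_is_cfc (is_cfcM ha hG) => t /spectrum_star_mul/andP[t0 _].
exact: tanhcE.
Qed.

Lemma cabs_Exp0 alpha : cabs (Exp0 alpha) = cfc (@tanh R) (cabs alpha).
Proof.
have [G hG _] := Exp0_tanhc alpha; rewrite (cabs_mul_Exp0 hG).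
have hz := is_cfc_comp (star_mul_Exp0 alpha) (is_cfc_cabs (Exp0 alpha)).
apply: (is_cfc_unique hz).
apply: eq_is_cfc (is_cfcM (is_cfc_cabs alpha) hG) => t /spectrum_star_mul/andP[t0 _].
by rewrite /= sqrt_tanh_sqr// tanhcE.
Qed.

Lemma unit_ball_sqr z : unit_ball z -> 0 <= cnorm z ^+ 2 < 1.
Proof.
move=> z1; rewrite sqr_ge0 -(expr1n _ 2) ltr_sqr// ?nnegrE ?cnorm_ge0//.
Qed.

Lemma unit_ball_itv z t : unit_ball z -> 0 <= t <= cnorm z ^+ 2 -> 0 <= t < 1.
Proof. by move=> /unit_ball_sqr/andP[_ z1] /andP[-> tz]; exact: le_lt_trans z1. Qed.

(** The inverse G of L is kept as well, because polar decompositions are carried back from [alpha]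
    to [z] by multiplying with G. *)
Lemma atanhc_exists z : unit_ball z -> exists L G,
  [/\ is_cfc (@atanhc R) (star z * z) L,
      is_cfc (@tanhc R \o @atanh_sqr R) (star z * z) G, L * G = 1 & G * L = 1].
Proof.
move=> z1; have zs := @spectrum_star_mul z.
have gc t : 0 <= t <= cnorm z ^+ 2 -> {for t, continuous (@tanhc R \o @atanh_sqr R)}.
  by move=> /(unit_ball_itv z1); exact: tanhc_atanh_sqr_continuous.
have [G hG] := is_cfc_exists (star_star_mul z) zs gc.
have [|uG hL] := is_cfc_unit hG zs gc.
  by move=> t _; rewrite /= gt_eqF// tanhc_gt0// atanh_sqr_ge0.
by exists G^-1, G; split; rewrite ?mulVr ?divrr.
Qed.

(** In each direction composition brings G and L into the calculus of one element:
    [star alpha * alpha] if z is given by [Exp0], and [star z * z] if alpha is z L. There the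
    product of their functions is 1 on the spectrum. *)
Lemma Exp0_eq z alpha L : unit_ball z -> is_cfc (@atanhc R) (star z * z) L ->
  Exp0 alpha = z <-> alpha = z * L.
Proof.
move=> z1 hL; split=> [zE|->].
  have [G hG E] := Exp0_tanhc alpha; have hz := star_mul_Exp0 alpha.
  rewrite zE in E hz; have := is_cfcM hG (is_cfc_comp hz hL).
  move=> /eq_is_cfc -/(_ (fun=> 1)) hGL.
  have GL : G * L = 1.
    apply: (is_cfc_unique (hGL _) (is_cfc1 (is_cfc_sa hG))) => t.
    move=> /spectrum_star_mul/andP[t0 _].
    by rewrite /= /atanhc atanh_tanh_sqr// divff// gt_eqF// tanhc_gt0.
  by rewrite E -mulrA GL mulr1.
have [G hG ->] := Exp0_tanhc (z * L).
have hs : is_cfc (@atanh_sqr R) (star z * z) (star (z * L) * (z * L)).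
  apply: eq_is_cfc (is_cfc_star_mul hL) => t /spectrum_star_mul.
  by move=> /(unit_ball_itv z1)/atanhc_sqr.
have LG : L * G = 1.
  apply: (is_cfc_unique _ (is_cfc1 (is_cfc_sa hL))).
  apply: eq_is_cfc (is_cfcM hL (is_cfc_comp hs hG)) => t _.
  by rewrite /= /atanhc mulVf// gt_eqF// tanhc_gt0// atanh_sqr_ge0.
by rewrite -mulrA LG mulr1.
Qed.

Lemma Log0E z L : unit_ball z -> is_cfc (@atanhc R) (star z * z) L -> Log0 z = z * L.
Proof.
move=> z1 hL; apply/(Exp0_eq _ z1 hL).
apply: (@xgetPex _ 0 [set alpha | Exp0 alpha = z]); exists (z * L).
by apply/(Exp0_eq _ z1 hL).
Qed.

Lemma cabs_mul_Log0 z L : unit_ball z -> is_cfc (@atanhc R) (star z * z) L ->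
  is_cfc (fun t => atanh (Num.sqrt t)) (star z * z) (cabs z * L).
Proof.
move=> z1 hL; apply: eq_is_cfc (is_cfcM (is_cfc_cabs z) hL) => t /spectrum_star_mul.
by move=> /(unit_ball_itv z1)/sqrt_atanhc.
Qed.

Lemma cabs_Log0_mul z L : unit_ball z -> is_cfc (@atanhc R) (star z * z) L ->
  cabs (Log0 z) = cabs z * L.
Proof.
move=> z1 hL; have hs : is_cfc (@atanh_sqr R) (star z * z) (star (z * L) * (z * L)).
  apply: eq_is_cfc (is_cfc_star_mul hL) => t /spectrum_star_mul.
  by move=> /(unit_ball_itv z1)/atanhc_sqr.
rewrite (Log0E z1 hL); apply: (is_cfc_unique (is_cfc_comp hs (is_cfc_cabs _))).
apply: eq_is_cfc (cabs_mul_Log0 z1 hL) => t /spectrum_star_mul.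
by move=> /(unit_ball_itv z1)/sqrt_atanh_sqr.
Qed.

Lemma cfc_ln z L : unit_ball z -> is_cfc (@atanhc R) (star z * z) L ->
  (2^-1 : R[i]) *: cfc (@ln R) ((1 + cabs z) * (1 - cabs z)^-1) = cabs z * L.
Proof.
move=> z1 hL; have sz := star_star_mul z; have zs := @spectrum_star_mul z.
have ha := is_cfc_cabs z.
have hp : is_cfc (fun t => 1 + Num.sqrt t) (star z * z) (1 + cabs z).
  exact: is_cfcD (is_cfc1 sz) ha.
have hm : is_cfc (fun t => 1 - Num.sqrt t) (star z * z) (1 - cabs z).
  have := is_cfcD (is_cfc1 sz) (is_cfcZ (-1) ha); rewrite rmorphN1 scaleN1r.
  by apply: eq_is_cfc => t _; rewrite mulN1r.
have sc t : {for t, continuous (@Num.sqrt R)} by exact: sqrt_continuous.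
have [||um hmV] := is_cfc_unit hm zs.
- by move=> t _; apply: cvgB; [exact: cvg_cst|exact: sc].
- by move=> t /(unit_ball_itv z1)/sqrt_lt1/andP[_ t1]; rewrite gt_eqF// subr_gt0.
have hW := is_cfcM hp hmV; set W := (1 + cabs z) * _ in hW *.
(* The spectrum of W must stay away from 0 for [ln] to be continuous on an interval around it; (1 +
   x) / (1 - x) >= 1 on [0, 1). *)
have WP s : spectrum W s%:C -> 1 <= s <= cnorm W.
  move=> sW; have /andP[_ ->] := spectrum_itv sW; rewrite andbT.
  have [|t tz <-] := is_cfc_spectrum_image hW zs _ sW.
    move=> t /(unit_ball_itv z1)/sqrt_lt1/andP[_ t1].
    apply: (@continuous_comp _ _ _ Num.sqrt (fun x : R => (1 + x) / (1 - x))); first exact: sc.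
    exact: ratio_continuous.
  exact/ratio_ge1/sqrt_lt1/(unit_ball_itv z1).
have [|T WT] := @is_cfc_exists _ _ (@ln R) W _ _ (is_cfc_star hW) WP.
  by move=> t /andP[t1 _]; apply: continuous_ln; apply: lt_le_trans t1.
rewrite (cfc_eq WT) -(rmorph_nat (real_complex R)) -fmorphV.
apply: (is_cfc_unique (is_cfcZ 2^-1 (is_cfc_comp hW WT))).
exact: cabs_mul_Log0.
Qed.

End Exponential.

(** * Transfer of polar decompositions *)

Section Polar.
Variables (R : realType) (A : cstarAlgType R) (H : hilbertType R).
Variable pi : A -> H -> H.
Hypothesis repr_pi : is_representation pi.

Lemma repr0 a : pi a 0 = 0.
Proof.
have [pb _ _ _ _] := repr_pi; have [pD _ _] := pb a.
by apply: (addrI (pi a 0)); rewrite -pD !addr0.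
Qed.

Lemma inner0 (x : H) : inner x 0 = 0.
Proof.
suff h : inner (0 : H) x = 0 by rewrite inner_conj h conjC0.
by rewrite -(scale0r 0) innerZl mul0r.
Qed.

(** The squared norm of z L x is the inner product of L x with [star z * z] L x, and L can be moved
    to the left of [star z * z], which kills x. *)
Lemma kernel_mulr z L x : GRing.comm (star z * z) L ->
  pi z x = 0 -> pi (z * L) x = 0.
Proof.
move=> zL zx; have [pb _ _ [pM _] pstar] := repr_pi.
apply/eqP; rewrite -normr_eq0 -sqrf_eq0 -inner_norm pM pstar -!pM.
by rewrite zL !pM zx !repr0 inner0.
Qed.

(** The hypotheses on L and G mirror each other, so one statement serves both directions; the two
    commutations give the two inclusions of kernels. *)
Lemma is_polar_mulr z alpha L G (omega : H -> H) :
  alpha = z * L -> z = alpha * G -> cabs alpha = cabs z * L ->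
  GRing.comm (star z * z) L -> GRing.comm (star alpha * alpha) G ->
  is_polar pi z omega -> is_polar pi alpha omega.
Proof.
move=> aE zE cE zL aG [env piso zpol ker]; have [pb _ _ [pM _] _] := repr_pi.
split=> //.
  by apply/funext => x; rewrite /= cE aE !pM zpol.
move=> x; rewrite ker; split=> [/(kernel_mulr zL)|/(kernel_mulr aG)].
  by rewrite -aE.
by rewrite -zE.
Qed.

End Polar.

Theorem corollary6p4 (R : realType) (A : cstarAlgType R) (H : hilbertType R)
    (pi : A -> H -> H) (hpi : is_universal_representation pi) :
  (* Exp0 and Log0 are mutually inverse bijections between A and the unit ball *)
  (forall alpha : A, unit_ball (Exp0 alpha)) /\
  (forall z alpha : A, unit_ball z -> (alpha = Log0 z <-> z = Exp0 alpha)) /\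
  (forall (z : A) (omega : H -> H), unit_ball z -> is_polar pi z omega ->
     pi (Log0 z) =
     (fun x => (2^-1 : R[i]) *:
        omega (pi (cfc (@ln R) ((1 + cabs z) * (1 - cabs z)^-1)) x))) /\
  (forall (alpha : A) (omega : H -> H), is_polar pi alpha omega ->
     pi (Exp0 alpha) = omega \o pi (cfc (@tanh R) (cabs alpha))) /\
  (forall z alpha : A, unit_ball z -> alpha = Log0 z ->
     forall omega : H -> H, is_polar pi z omega <-> is_polar pi alpha omega) /\
  (forall alpha : A, cabs (Exp0 alpha) = cfc (@tanh R) (cabs alpha)) /\
  (forall z : A, unit_ball z ->
     cabs (Log0 z) =
     (2^-1 : R[i]) *: cfc (@ln R) ((1 + cabs z) * (1 - cabs z)^-1)).
Proof.
have [rpi _] := hpi; have [pb pD pZ [pM p1] pstar] := rpi.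
split; first exact: unit_ball_Exp0.
split.
  move=> z alpha z1; have [L [G [hL _ _ _]]] := atanhc_exists z1.
  by rewrite (Log0E z1 hL); split=> [/(Exp0_eq _ z1 hL)|/esym/(Exp0_eq _ z1 hL)].
split.
  move=> z omega z1 [[[_ oZ _] _] _ zpol _].
  have [L [G [hL _ _ _]]] := atanhc_exists z1.
  apply/funext => x; rewrite -oZ -pZ (cfc_ln z1 hL) (Log0E z1 hL).
  by rewrite !pM zpol.
split.
  move=> alpha omega [_ _ apol _]; have [G hG ->] := Exp0_tanhc alpha.
  by apply/funext => x; rewrite /= (cabs_mul_Exp0 hG) !pM apol.
split; last first.
  split; first exact: cabs_Exp0.
  move=> z z1; have [L [G [hL _ _ _]]] := atanhc_exists z1.
  by rewrite (cfc_ln z1 hL); exact: cabs_Log0_mul.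
move=> z alpha z1 aE omega; have [L [G [hL hG LG GL]]] := atanhc_exists z1.
have cE : cabs alpha = cabs z * L by rewrite aE (cabs_Log0_mul z1 hL).
rewrite (Log0E z1 hL) in aE.
have zE : z = alpha * G by rewrite aE -mulrA LG mulr1.
have czE : cabs z = cabs alpha * G by rewrite cE -mulrA LG mulr1.
have cL := is_cfc_comm hL; have cG := is_cfc_comm hG.
(* Here [star alpha * alpha] is L ([star z * z]) L, and G commutes with [star z * z] and with its
   own inverse L. *)
have caG : GRing.comm (star alpha * alpha) G.
  rewrite aE starM (is_cfc_star hL) mulrA -(mulrA L).
  by apply/commr_sym/commrM; [apply: commrM|]; rewrite /GRing.comm ?LG ?GL.
split; first exact: (is_polar_mulr rpi aE zE cE cL caG).
exact: (is_polar_mulr rpi zE aE czE caG cL).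
Qed.
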